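(* Let $\mathfrak{H}$ be a complex Hilbert space (finite or infinite dimensional) and let $r>1$ be a real number. Let $M: B(\mathfrak{H})^{+}\times B(\mathfrak{H})^{+}\to B(\mathfrak{H})^{+}$ be a map such that for all $A,B\in B(\mathfrak{H})^{+}$: (i) $M(A,B)\geq rA+(1-r)B$; (ii) $M(tA,B)=t^{r}M(A,B)$ for every real number $t>0$; (iii) $M(A,B)^{-1}=M(A^{-1},B^{-1})$. Then $M=M_{r}$, i.e. $M(A,B)=B^{1/2}(B^{-1/2}AB^{-1/2})^{r}B^{1/2}$ for all $A,B\in B(\mathfrak{H})^{+}$.
   Context: $B(\mathfrak{H})$ denotes the bounded linear operators on $\mathfrak{H}$, and $B(\mathfrak{H})^{+}$ denotes the set of all positive invertible operators in $B(\mathfrak{H})$. The order $\geq$ is the usual order on self-adjoint operators ($S\ge T$ iff $\langle (S-T)\xi,\xi\rangle\ge 0$ for all $\xi\in\mathfrak{H}$), scalars are identified with scalar multiples of the identity, and real powers of positive invertible operators are defined by the continuous functional calculus. For $r>0$ and $A,B\in B(\mathfrak{H})^{+}$, $M_{r}(A,B)=B^{1/2}(B^{-1/2}AB^{-1/2})^{r}B^{1/2}$. The map $M$ is not assumed to be continuous or to have any property other than those listed. *)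

(* Defs.v *)
From HB Require Import structures.
From mathcomp Require Import all_boot all_order all_algebra.
From mathcomp Require Import sesquilinear complex.
From mathcomp Require Import all_classical all_reals all_analysis.
Set Implicit Arguments.
Unset Strict Implicit.
Unset Printing Implicit Defensive.
Import Order.TTheory GRing.Theory Num.Theory numFieldNormedType.Exports.
Local Open Scope classical_set_scope.
Local Open Scope ring_scope.
Local Open Scope complex_scope.

Section BoundedOperators.
Context {R : realType} (H : normedModType R[i]).

Record bop := Bop {
  bop_fun :> H -> H;
  bop_linear : linear bop_fun;
  bop_bounded : exists c : R, forall x, `|bop_fun x| <= c%:C * `|x| }.

HB.instance Definition _ (A : bop) :=
  GRing.isLinear.Build R[i] H H *:%R (bop_fun A) (bop_linear A).

HB.instance Definition _ := gen_eqMixin bop.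
HB.instance Definition _ := gen_choiceMixin bop.

Lemma bopP (A B : bop) : (forall x, A x = B x) -> A = B.
Proof.
case: A B => [f lf bf] [g lg bg] /= /funext fg; case: _ / fg in lg bg *.
by congr Bop; exact: Prop_irrelevance.
Qed.

Lemma bop_bound (A : bop) :
  exists2 c : R, 0 <= c & forall x, `|A x| <= c%:C * `|x|.
Proof.
have [c Ac] := bop_bounded A; exists `|c| => // x.
by apply: le_trans (Ac x) _; rewrite ler_wpM2r// lecR ler_norm.
Qed.

Fact bop0_linear : linear (fun _ : H => 0 : H).
Proof. by move=> a x y; rewrite scaler0 addr0. Qed.

Fact bop0_bounded : exists c : R, forall x : H, `|0 : H| <= c%:C * `|x|.
Proof. by exists 0 => x; rewrite normr0 mul0r. Qed.

Definition bop0 := Bop bop0_linear bop0_bounded.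

Fact bop1_linear : linear (fun x : H => x).
Proof. by []. Qed.

Fact bop1_bounded : exists c : R, forall x : H, `|x| <= c%:C * `|x|.
Proof. by exists 1 => x; rewrite mul1r. Qed.

Definition bop1 := Bop bop1_linear bop1_bounded.

Fact bopD_linear (A B : bop) : linear (fun x => A x + B x).
Proof. by move=> a x y; rewrite !linearP scalerDr addrACA. Qed.

Fact bopD_bounded (A B : bop) :
  exists c : R, forall x, `|A x + B x| <= c%:C * `|x|.
Proof.
have [a _ Aa] := bop_bound A; have [b _ Bb] := bop_bound B; exists (a + b) => x.
by rewrite rmorphD mulrDl (le_trans (ler_normD _ _))// lerD.
Qed.

Definition bopD A B := Bop (bopD_linear A B) (bopD_bounded A B).

Fact bopZ_linear (k : R[i]) (A : bop) : linear (fun x => k *: A x).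
Proof. by move=> a x y; rewrite linearP scalerDr !scalerA mulrC. Qed.

Fact bopZ_bounded (k : R[i]) (A : bop) :
  exists c : R, forall x, `|k *: A x| <= c%:C * `|x|.
Proof.
have [a _ Aa] := bop_bound A; exists (Normc.normc k * a) => x.
by rewrite normrZ rmorphM -mulrA; exact: ler_wpM2l.
Qed.

Definition bopZ k A := Bop (bopZ_linear k A) (bopZ_bounded k A).

Fact bopM_linear (A B : bop) : linear (fun x => A (B x)).
Proof. by move=> a x y; rewrite !linearP. Qed.

Fact bopM_bounded (A B : bop) :
  exists c : R, forall x, `|A (B x)| <= c%:C * `|x|.
Proof.
have [a a0 Aa] := bop_bound A; have [b _ Bb] := bop_bound B; exists (a * b) => x.
by rewrite (le_trans (Aa _))// rmorphM -mulrA ler_wpM2l// lecR.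
Qed.

Definition bopM A B := Bop (bopM_linear A B) (bopM_bounded A B).

Fact bopDA : associative bopD.
Proof. by move=> A B C; apply: bopP => x /=; rewrite addrA. Qed.
Fact bopDC : commutative bopD.
Proof. by move=> A B; apply: bopP => x /=; rewrite addrC. Qed.
Fact bop0D : left_id bop0 bopD.
Proof. by move=> A; apply: bopP => x /=; rewrite add0r. Qed.
Fact bopND : left_inverse bop0 (bopZ (-1)) bopD.
Proof. by move=> A; apply: bopP => x /=; rewrite scaleN1r addNr. Qed.

HB.instance Definition _ := GRing.isZmodule.Build bop bopDA bopDC bop0D bopND.

Fact bopMA : associative bopM.
Proof. by move=> A B C; apply: bopP. Qed.
Fact bop1M : left_id bop1 bopM.
Proof. by move=> A; apply: bopP. Qed.
Fact bopM1 : right_id bop1 bopM.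
Proof. by move=> A; apply: bopP. Qed.
Fact bopMDl : left_distributive bopM bopD.
Proof. by move=> A B C; apply: bopP. Qed.
Fact bopMDr : right_distributive bopM bopD.
Proof. by move=> A B C; apply: bopP => x /=; rewrite linearD. Qed.

(* The zero space is allowed, so this ring may be trivial *)
HB.instance Definition _ :=
  GRing.Zmodule_isPzRing.Build bop bopMA bop1M bopM1 bopMDl bopMDr.

Fact bopZA a b A : bopZ a (bopZ b A) = bopZ (a * b) A.
Proof. by apply: bopP => x /=; rewrite scalerA. Qed.
Fact bopZ1 : left_id 1 bopZ.
Proof. by move=> A; apply: bopP => x /=; rewrite scale1r. Qed.
Fact bopZDr : right_distributive bopZ +%R.
Proof. by move=> a A B; apply: bopP => x /=; rewrite scalerDr. Qed.
Fact bopZDl A : {morph bopZ^~ A : a b / a + b}.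
Proof. by move=> a b; apply: bopP => x /=; rewrite scalerDl. Qed.

HB.instance Definition _ :=
  GRing.Zmodule_isLmodule.Build R[i] bop bopZA bopZ1 bopZDr bopZDl.

Definition bop_invertible (A : bop) := exists B : bop, A * B = 1 /\ B * A = 1.

(* the inverse of A if A is invertible, 0 otherwise *)
Definition bop_inv (A : bop) : bop := xget 0 [set B | A * B = 1 /\ B * A = 1].

Definition spectrum (A : bop) : set R[i] :=
  [set z | ~ bop_invertible (A - z *: (1 : bop))].

Definition poly_bop (p : {poly R}) (A : bop) : bop :=
  \sum_(i < size p) (p`_i)%:C *: A ^+ i.

Definition bop_norm_cvg (T_ : nat -> bop) (T : bop) :=
  forall e : R, 0 < e -> \forall n \near \oo,
    forall x, `|(T_ n - T) x| <= e%:C * `|x|.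

(* T = f(A): T is the operator-norm limit of p_n(A) for real polynomials p_n
   converging to f uniformly on the spectrum of A. When A is self-adjoint, its
   spectrum is real; if f is moreover continuous on it, such a T exists, is
   unique and does not depend on the p_n. Only meant for self-adjoint A. *)
Definition is_functional_calculus (A : bop) (f : R -> R) (T : bop) :=
  exists p : nat -> {poly R},
    (forall e : R, 0 < e -> \forall n \near \oo,
       forall x : R, spectrum A x%:C -> `|(p n).[x] - f x| <= e) /\
    bop_norm_cvg (fun n => poly_bop (p n) A) T.

Definition functional_calculus (A : bop) (f : R -> R) : bop :=
  xget 0 (is_functional_calculus A f).

Definition bop_pow (A : bop) (s : R) : bop :=
  functional_calculus A (fun x => x `^ s).

Definition geom_mean (r : R) (A B : bop) : bop :=
  bop_pow B 2^-1 *
  bop_pow (bop_pow B (- 2^-1) * A * bop_pow B (- 2^-1)) r *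
  bop_pow B 2^-1.

Variable dot : {dot H for Num.conj}.

Definition bop_selfadjoint (A : bop) := forall x y, dot (A x) y = dot x (A y).

(* In R[i], 0 <= z means that z is real and nonnegative *)
Definition bop_le (T S : bop) := forall x, 0 <= dot ((S - T) x) x.

Definition bop_posinv (A : bop) :=
  [/\ bop_selfadjoint A, bop_le 0 A & bop_invertible A].

End BoundedOperators.

Arguments bop {R} H.

(* Main.v *)
Require Import Defs.
From HB Require Import structures.
From mathcomp Require Import all_boot all_order all_algebra.
From mathcomp Require Import sesquilinear complex ring lra.
From mathcomp Require Import all_classical all_reals all_analysis.
From mathcomp Require Import zify.
Import Order.TTheory GRing.Theory Num.Theory numFieldNormedType.Exports.
Local Open Scope ring_scope.
Local Open Scope complex_scope.

Set Implicit Arguments.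
Unset Strict Implicit.
Unset Printing Implicit Defensive.

(** Write [f_s x = r s^(r-1) x + (1-r) s^r] for the tangent of [x^r] at [s].
    Fix [A] and [B], and put [C = B^(-1/2) A B^(-1/2)] and
    [X = B^(-1/2) M(A,B) B^(-1/2)]. Homogeneity and the lower bound [M_ge] at
    [A / s] give [X >= f_s(C)] for every [s > 0]; compatibility with inverses
    then gives [X^-1 >= f_s(C^-1)] ([tangent_le] in the final proof).
    The claim is that these two families of inequalities force [X = C^r]
    ([eq_pow_of_tangents]). Scalars satisfy it at once because [x^r] is the
    supremum of its tangents; the difficulty is that [X] and [C] are not known
    to commute.

    Let [T = X^-1 - C^(-r)]. The tangents have second order contact, so the
    second family yields [T >= - K (C - s)^2] for all [s] in the spectrum of
    [C] ([inverse_lower_bound]). Suppose that also [T <= K (C - s)^2] for all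
    [s] of the spectrum up to some [c]. Then [|T x| <= L |(C - s) x|] for these
    [s] ([form_to_norm]), and [T] vanishes on the part of the spectrum below
    [c] ([first_order_vanishing]): cut a vector into [n] almost orthogonal
    spectral pieces of width [O(1/n)]; each is mapped to a vector of size
    [O(1/n)] times its norm, so the sum of the images is [O(n^(-1/2))].

    The upper bound comes from inverting [X >= f_s(C)], which is possible only
    where [f_s] is positive, that is for [x > s (r-1)/r]. At the bottom of the
    spectrum this holds for all [s] in a window of fixed ratio. Once [T] is
    known to vanish below [c], the operators [X] and [C^r] agree there, the
    tangent can be replaced by [x^r] below [c], and the resulting lower bound
    of [X] is positive for [s] in the next window [[c, k c]]
    ([upper_bound_step]). Finitely many windows cover the spectrum, so [T = 0].

    The functional calculus is built for Lipschitz functions on a segment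
    containing the spectrum. It rests on a single positivity statement,
    [psd_poly_bop]: a polynomial that is nonnegative on the spectrum of a
    self-adjoint operator gives a positive operator. *)

(** * Lipschitz functions on a segment and their polynomial approximation *)

Section Lipschitz.
Context {R : realType}.
Implicit Types (a b x y e : R) (f g : R -> R) (p : {poly R}).

Definition on_segment a b (P : R -> Prop) := forall x, a <= x <= b -> P x.

(** Powers away from 0, truncations and quotients are all Lipschitz, and for
    this class polynomial approximation has a rate that depends on the
    constant alone, so that no compactness argument is needed. *)
Definition lip_on a b f :=
  exists2 L, 0 <= L &
    on_segment a b (fun x => on_segment a b (fun y => `|f x - f y| <= L * `|x - y|)).

Lemma lip_bounded a b f : lip_on a b f ->
  exists2 c, 0 <= c & on_segment a b (fun x => `|f x| <= c).
Proof.
move=> [L L0 fL]; have [ab|ba] := leP a b; last first.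
  by exists 0 => // x /andP[/le_trans h /h]; rewrite leNgt ba.
exists (`|f a| + L * (b - a)) => [|x xab].
  by rewrite addr_ge0// mulr_ge0// subr_ge0.
rewrite -[f x](subrK (f a)) addrC (le_trans (ler_normD _ _))// lerD2l.
have aab : a <= a <= b by rewrite lexx.
apply: le_trans (fL _ xab _ aab) _; rewrite ler_wpM2l//.
by case/andP: xab => ax xb; rewrite ger0_norm ?subr_ge0// lerD2r.
Qed.

Lemma lip_cst a b c : lip_on a b (fun=> c).
Proof. by exists 0 => // x _ y _; rewrite subrr normr0 mul0r. Qed.

Lemma lip_id a b : lip_on a b id.
Proof. by exists 1 => // x _ y _; rewrite mul1r. Qed.

Lemma lip_ext a b f g : on_segment a b (fun x => f x = g x) ->
  lip_on a b f -> lip_on a b g.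
Proof.
by move=> fg [L L0 fL]; exists L => // x xab y yab; rewrite -!fg//; exact: fL.
Qed.

Lemma lip_add a b f g :
  lip_on a b f -> lip_on a b g -> lip_on a b (fun x => f x + g x).
Proof.
move=> [L L0 fL] [K K0 gK]; exists (L + K) => [|x xab y yab].
  by rewrite addr_ge0.
rewrite opprD addrACA mulrDl (le_trans (ler_normD _ _))// lerD//.
- exact: fL.
- exact: gK.
Qed.

Lemma lip_mul a b f g :
  lip_on a b f -> lip_on a b g -> lip_on a b (fun x => f x * g x).
Proof.
move=> lf lg; have [F F0 fF] := lip_bounded lf; have [G G0 gG] := lip_bounded lg.
case: lf lg => [L L0 fL] [K K0 gK]; exists (F * K + L * G) => [|x xab y yab].
  by rewrite addr_ge0// mulr_ge0.
have -> : f x * g x - f y * g y = f x * (g x - g y) + (f x - f y) * g y by ring.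
rewrite (le_trans (ler_normD _ _))// !normrM mulrDl lerD//.
  by rewrite -mulrA ler_pM// ?fF// gK.
by rewrite mulrAC ler_pM// ?gG// fL.
Qed.

Lemma lip_opp a b f : lip_on a b f -> lip_on a b (fun x => - f x).
Proof.
move=> lf; apply: lip_ext (lip_mul (lip_cst a b (-1)) lf) => x _.
by rewrite mulN1r.
Qed.

Lemma lip_sub a b f g :
  lip_on a b f -> lip_on a b g -> lip_on a b (fun x => f x - g x).
Proof. by move=> lf lg; apply: lip_add lf (lip_opp lg). Qed.

Lemma lip_norm a b f : lip_on a b f -> lip_on a b (fun x => `|f x|).
Proof.
move=> [L L0 fL]; exists L => // x xab y yab.
by apply: le_trans (fL _ xab _ yab); exact: ler_dist_dist.
Qed.

Lemma lip_max a b f g : lip_on a b f -> lip_on a b g ->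
  lip_on a b (fun x => Num.max (f x) (g x)).
Proof.
move=> lf lg; have := lip_mul (lip_cst a b 2^-1)
  (lip_add (lip_add lf lg) (lip_norm (lip_sub lf lg))).
by apply: lip_ext => x _; rewrite maxr_absE mulrC.
Qed.

Lemma lip_min a b f g : lip_on a b f -> lip_on a b g ->
  lip_on a b (fun x => Num.min (f x) (g x)).
Proof.
move=> lf lg; have := lip_mul (lip_cst a b 2^-1)
  (lip_sub (lip_add lf lg) (lip_norm (lip_sub lf lg))).
by apply: lip_ext => x _; rewrite minr_absE mulrC.
Qed.

Lemma lip_inv a b f c : 0 < c -> on_segment a b (fun x => c <= `|f x|) ->
  lip_on a b f -> lip_on a b (fun x => (f x)^-1).
Proof.
move=> c0 cf [L L0 fL]; exists (c^-1 * L * c^-1) => [|x xab y yab].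
  by rewrite !mulr_ge0// invr_ge0 ltW.
have fx0 : f x != 0 by rewrite -normr_gt0 (lt_le_trans c0)// cf.
have fy0 : f y != 0 by rewrite -normr_gt0 (lt_le_trans c0)// cf.
have -> : (f x)^-1 - (f y)^-1 = (f x)^-1 * (f y - f x) * (f y)^-1.
  by field; rewrite fx0 fy0.
have ci z : a <= z <= b -> `|(f z)^-1| <= c^-1.
  by move=> zab; rewrite normfV lef_pV2 ?posrE ?cf// (lt_le_trans c0)// cf.
rewrite !normrM (_ : _ * `|x - y| = c^-1 * (L * `|x - y|) * c^-1); last by ring.
by rewrite ler_pM ?mulr_ge0// ?ci// ler_pM// ?ci// distrC fL.
Qed.

(** The Bernstein operator for a sequence of sampled values, through Pascal's
    rule: evaluated at [x] it is the mean of [g] under the binomial law with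
    parameters [n] and [x]. *)
Fixpoint bernstein n (g : nat -> R) : {poly R} :=
  if n is n'.+1 then
    'X * bernstein n' (fun k => g k.+1) + (1 - 'X) * bernstein n' g
  else (g 0%N)%:P.

Lemma bernsteinS n (g : nat -> R) x : (bernstein n.+1 g).[x] =
  x * (bernstein n (fun k => g k.+1)).[x] + (1 - x) * (bernstein n g).[x].
Proof. by rewrite /= !hornerE. Qed.

Lemma bernstein_cst n c x : (bernstein n (fun=> c)).[x] = c.
Proof.
by elim: n => [|n IH]; rewrite ?bernsteinS ?IH/= ?hornerE//; ring.
Qed.

Lemma bernsteinD n (g h : nat -> R) x : (bernstein n (fun k => g k + h k)).[x] =
  (bernstein n g).[x] + (bernstein n h).[x].
Proof.
elim: n g h => [|n IH] g h; first by rewrite /= !hornerE.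
by rewrite !bernsteinS !IH; ring.
Qed.

Lemma bernsteinZ n (g : nat -> R) c x :
  (bernstein n (fun k => c * g k)).[x] = c * (bernstein n g).[x].
Proof.
elim: n g => [|n IH] g; first by rewrite /= !hornerE.
by rewrite !bernsteinS !IH; ring.
Qed.

Lemma bernstein_le n (g h : nat -> R) x : 0 <= x <= 1 -> (forall k, (k <= n)%N -> g k <= h k) ->
  (bernstein n g).[x] <= (bernstein n h).[x].
Proof.
move=> /andP[x0 x1]; elim: n g h => [|n IH] g h gh.
  by rewrite /= !hornerE gh.
rewrite !bernsteinS lerD// ler_wpM2l ?subr_ge0// IH// => k kn; apply: gh => //.
by rewrite (leq_trans kn).
Qed.

Lemma bernstein_variance n c x :
  (bernstein n (fun k => (k%:R - c) ^+ 2)).[x] =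
  (n%:R * x - c) ^+ 2 + n%:R * x * (1 - x).
Proof.
elim: n c => [|n IH] c; first by rewrite /= !hornerE; ring.
rewrite bernsteinS IH.
have -> : (fun k => (k.+1%:R - c) ^+ 2) = (fun k : nat => (k%:R - (c - 1)) ^+ 2).
  by apply/funext => k; rewrite -natr1; ring.
by rewrite IH -natr1; ring.
Qed.

(** The mean distance of the binomial law from its centre is at most its
    standard deviation, which tends to 0. The inequality
    [z <= d + z^2 / (4 d)] replaces the square root by the variance itself. *)
Lemma bernstein_approx L e : 0 <= L -> 0 < e -> exists n : nat,
  forall f, (forall x y, 0 <= x <= 1 -> 0 <= y <= 1 ->
       `|f x - f y| <= L * `|x - y|) ->
  forall x, 0 <= x <= 1 ->
    `|(bernstein n.+1 (fun k => f (k%:R / n.+1%:R))).[x] - f x| <= e.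
Proof.
move=> L0 e0; pose d := e / (2 * (L + 1)).
have L1 : 0 < L + 1 by rewrite ltr_wpDl.
have d0 : 0 < d by rewrite divr_gt0// mulr_gt0.
have [n ndL] : exists n : nat, (4 * d ^+ 2)^-1 <= n.+1%:R.
  exists (Num.truncn (4 * d ^+ 2)^-1); apply/ltW.
  exact: truncnS_gt.
exists n => f fL x x01; set N : R := n.+1%:R; have N0 : 0 < N by rewrite ltr0n.
have /andP[x0 x1] := x01.
have key k : (k <= n.+1)%N ->
    `|f (k%:R / N) - f x| <= L * (d + (4 * d * N ^+ 2)^-1 * (k%:R - N * x) ^+ 2).
  move=> kn; have k01 : 0 <= k%:R / N <= 1.
    by rewrite divr_ge0// ?ler0n// ler_pdivrMr// mul1r ler_nat.
  apply: le_trans (fL _ _ k01 x01) _; rewrite ler_wpM2l//.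
  have -> : (4 * d * N ^+ 2)^-1 * (k%:R - N * x) ^+ 2 =
      (4 * d)^-1 * `|k%:R / N - x| ^+ 2.
    rewrite real_normK ?num_real//; field.
    by rewrite !gt_eqF.
  set z := `|_|; rewrite -subr_ge0.
  have -> : d + (4 * d)^-1 * z ^+ 2 - z = (4 * d)^-1 * (z - 2 * d) ^+ 2.
    by field; rewrite gt_eqF.
  by rewrite mulr_ge0 ?sqr_ge0// invr_ge0 mulr_ge0// ltW.
have mean : (bernstein n.+1
    (fun k => L * (d + (4 * d * N ^+ 2)^-1 * (k%:R - N * x) ^+ 2))).[x] <= e.
  rewrite bernsteinZ bernsteinD bernstein_cst bernsteinZ bernstein_variance.
  rewrite -/N subrr expr0n/= add0r.
  have h : (4 * d * N ^+ 2)^-1 * (N * x * (1 - x)) <= d.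
    have -> : (4 * d * N ^+ 2)^-1 * (N * x * (1 - x)) =
              (4 * d * N)^-1 * (x * (1 - x)).
      by field; rewrite !gt_eqF.
    apply: (@le_trans _ _ ((4 * d * N)^-1)).
      have xx : x * (1 - x) <= 1 by rewrite mulr_ile1// ?subr_ge0// lerBlDr lerDl.
      rewrite -[leRHS]mulr1 ler_wpM2l// invr_ge0.
      by rewrite mulr_ge0 ?ler0n// mulr_ge0 ?ler0n// ltW.
    have -> : (4 * d * N)^-1 = (4 * d ^+ 2)^-1 * (d / N).
      by field; rewrite !gt_eqF.
    apply: (@le_trans _ _ (N * (d / N))); last by rewrite mulrC divfK// gt_eqF.
    by rewrite ler_wpM2r// divr_ge0// ltW.
  apply: (@le_trans _ _ (L * (d + d))); first by rewrite ler_wpM2l// lerD2l.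
  have -> : d + d = e / (L + 1) by rewrite /d; field; rewrite gt_eqF.
  rewrite mulrCA ger_pMr// ler_pdivrMr// mul1r.
  by rewrite lerDl.
have sandwich h : (forall k, (k <= n.+1)%N -> `|f (k%:R / N) - f x| <= h k) ->
   (bernstein n.+1 h).[x] <= e ->
   `|(bernstein n.+1 (fun k => f (k%:R / N))).[x] - f x| <= e.
  move=> fh he; rewrite ler_norml; apply/andP; split.
    rewrite lerNl opprB lerBlDr.
    apply: (@le_trans _ _ ((bernstein n.+1 (fun k => f (k%:R / N) + h k)).[x])).
      rewrite -[leLHS](bernstein_cst n.+1 (f x) x) bernstein_le// => k /fh.
      by rewrite distrC ler_norml => /andP[_]; rewrite lerBlDl.
    by rewrite bernsteinD addrC lerD2r.
  rewrite lerBlDr.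
  apply: (@le_trans _ _ ((bernstein n.+1 (fun k => h k + f x)).[x])).
    rewrite bernstein_le// => k /fh.
    by rewrite ler_norml => /andP[_]; rewrite lerBlDr.
  by rewrite bernsteinD bernstein_cst lerD2r.
exact: sandwich key mean.
Qed.

(** Bernstein approximation on the unit interval, after an affine change of
    variable. *)
Lemma lip_approx a b f : a < b -> lip_on a b f -> forall e, 0 < e ->
  exists p, on_segment a b (fun x => `|p.[x] - f x| <= e).
Proof.
move=> ab [L L0 fL] e e0; have ba0 : 0 < b - a by rewrite subr_gt0.
pose F u := f (a + (b - a) * u).
have seg u : 0 <= u <= 1 -> a <= a + (b - a) * u <= b.
  move=> /andP[u0 u1]; rewrite lerDl mulr_ge0 ?(ltW ba0)//= -lerBrDl.
  by rewrite ger_pMr.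
have [n nP] := @bernstein_approx (L * (b - a)) e (mulr_ge0 L0 (ltW ba0)) e0.
exists (bernstein n.+1 (fun k => F (k%:R / n.+1%:R)) \Po
        ((b - a)^-1 *: ('X - a%:P))) => x /andP[ax xb].
rewrite horner_comp hornerZ hornerXsubC; set u := (b - a)^-1 * _.
have xu : x = a + (b - a) * u by rewrite /u; field; rewrite gt_eqF.
rewrite [f x](_ : _ = F u); last by rewrite /F -xu.
apply: nP.
  move=> v w /seg v01 /seg w01; apply: le_trans (fL _ v01 _ w01) _.
  rewrite -mulrA ler_wpM2l//.
  rewrite [X in `|X|](_ : _ = (b - a) * (v - w)); last by ring.
  by rewrite normrM ger0_norm// ltW.
apply/andP; split; first by rewrite /u mulr_ge0 ?invr_ge0 ?subr_ge0// ltW.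
by rewrite /u mulrC ler_pdivrMr// mul1r lerD2r.
Qed.

Lemma powR_Vl x s : 0 < x -> x^-1 `^ s = (x `^ s)^-1.
Proof.
move=> x0; apply: (mulIf (lt0r_neq0 (powR_gt0 s x0))).
rewrite -powRM ?invr_ge0 ?(ltW x0)// mulVf ?gt_eqF// powR1.
by rewrite mulVf// gt_eqF// powR_gt0.
Qed.

Lemma powR_le_ends a b s x : 0 < a -> a <= x <= b ->
  x `^ s <= a `^ s + b `^ s.
Proof.
move=> a0 /andP[ax xb]; have x0 := lt_le_trans a0 ax.
have b0 := lt_le_trans x0 xb.
have [s0|s0] := leP 0 s.
  rewrite -[leLHS]add0r lerD ?powR_ge0// ge0_ler_powR// ?nnegrE ltW//.
rewrite -[leLHS]addr0 lerD ?powR_ge0//.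
rewrite -[s]opprK 2!(powRN _ (- s)) lef_pV2 ?posrE ?powR_gt0//.
by rewrite ge0_ler_powR// ?nnegrE ltW// oppr_gt0.
Qed.

Lemma powR_mean_value s x y : 0 < x -> x <= y ->
  exists2 c, x <= c <= y & y `^ s - x `^ s = s * c `^ (s - 1) * (y - x).
Proof.
move=> x0 xy; have der (c : R) : 0 < c ->
    is_derive c (1 : R) (fun z : R => z `^ s) (s * c `^ (s - 1)).
  move=> c0; have ci : c \in `]0, +oo[ by rewrite in_itv/= c0.
  apply: DeriveDef; first exact: derivable_powR.
  by rewrite -powR_derive1// derive1E.
have [c||c cxy ->] := @MVT_segment R (fun z => z `^ s)
    (fun c => s * c `^ (s - 1)) x y xy.
- by rewrite in_itv/= => /andP[xc _]; apply: der; exact: lt_trans xc.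
- apply: derivable_within_continuous => c; rewrite in_itv/= => /andP[xc _].
  by have /der[] := lt_le_trans x0 xc.
- by exists c => //; rewrite in_itv/= in cxy.
Qed.

Lemma lip_powR a b s : 0 < a -> lip_on a b (fun x => x `^ s).
Proof.
move=> a0; exists (`|s| * (a `^ (s - 1) + b `^ (s - 1))) => [|x xab y yab].
  by rewrite mulr_ge0// addr_ge0// powR_ge0.
wlog xy : x y xab yab / x <= y.
  by move=> h; have [/h->//|/ltW/h] := leP x y; rewrite distrC [`|x - y|]distrC => ->.
have /andP[ax _] := xab; have /andP[_ yb] := yab.
have [c /andP[xc cy] E] := powR_mean_value s (lt_le_trans a0 ax) xy.
rewrite distrC E !normrM [`|x - y|]distrC ler_wpM2r// ler_wpM2l//.
by rewrite ger0_norm ?powR_ge0// powR_le_ends// (le_trans ax)//= (le_trans cy).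
Qed.

(** The tangent of [x `^ r] at [x = s], expanded. *)
Definition pow_tangent (r s x : R) := r * s `^ (r - 1) * x + (1 - r) * s `^ r.


(** The mean value theorem gives the error the form
    [r (c^(r-1) - s^(r-1)) (x - s)] with [c] between [s] and [x], and [x^(r-1)]
    is again Lipschitz. *)
Lemma pow_tangent_approx a b r : 0 < a -> 0 < r -> exists2 K, 0 <= K &
  forall x s, a <= x <= b -> a <= s <= b ->
    `|x `^ r - pow_tangent r s x| <= K * (x - s) ^+ 2.
Proof.
move=> a0 r0; have [L L0 gL] := lip_powR b (r - 1) a0.
exists (r * L) => [|x s xab sab]; first by rewrite mulr_ge0// ltW.
have /andP[ax xb] := xab; have /andP[sa sb] := sab.
have s0 := lt_le_trans a0 sa; have x0 := lt_le_trans a0 ax.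
have [c [cab cs E]] : exists c, [/\ a <= c <= b, `|c - s| <= `|x - s| &
    x `^ r - s `^ r = r * c `^ (r - 1) * (x - s)].
  have [xs|/ltW sx] := leP x s.
    have [c /andP[xc cs] E] := powR_mean_value r x0 xs.
    exists c; split; first by rewrite (le_trans ax)//= (le_trans cs).
      by rewrite !ler0_norm ?subr_le0// lerN2 lerD2r.
    by rewrite -opprB E; ring.
  have [c /andP[sc cx] E] := powR_mean_value r s0 sx.
  exists c; split => //; first by rewrite (le_trans sa)//= (le_trans cx).
  by rewrite !ger0_norm ?subr_ge0// lerD2r.
rewrite [X in `|X|](_ : _ = r * (c `^ (r - 1) - s `^ (r - 1)) * (x - s)); last first.
  have -> : x `^ r = s `^ r + r * c `^ (r - 1) * (x - s) by rewrite -E; ring.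
  by rewrite /pow_tangent -(mulr_powRB1 (ltW s0) r0); ring.
rewrite !normrM (ger0_norm (ltW r0)) -(real_normK (num_real (x - s))) expr2 mulrA.
rewrite ler_wpM2r// -mulrA ler_wpM2l ?(ltW r0)//.
by apply: le_trans (gL _ cab _ sab) _; rewrite ler_wpM2l.
Qed.

End Lipschitz.

(** * The underlying real Hilbert space *)

Section Hilbert.
Local Notation Re := complex.Re.
Local Notation Im := complex.Im.
Context {R : realType} {H : completeNormedModType R[i]}.
Context (dot : {dot H for Num.conj}).
Context (norm_dot : forall x : H, `|x| ^+ 2 = dot x x).
Implicit Types (x y z : H) (A B C S T : bop H) (p q : {poly R}) (a b c e t : R).

(** The size and the sign of a complex linear self-adjoint operator are
    determined by the real part of the inner product, so that all estimates
    take place in the real Hilbert space underlying [H]. *)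
Definition ip x y : R := Re (dot x y).
Definition nrm x : R := Re `|x|.

Lemma ReD (u v : R[i]) : Re (u + v) = Re u + Re v.
Proof. by case: u v => ? ? [? ?]. Qed.

Lemma ReN (u : R[i]) : Re (- u) = - Re u.
Proof. by case: u. Qed.

Lemma ReCM a (u : R[i]) : Re (a%:C * u) = a * Re u.
Proof. by case: u => ? ? /=; rewrite mul0r subr0. Qed.

Lemma dotC x y : dot x y = (dot y x)^*.
Proof. by rewrite hermC/= expr0 mul1r. Qed.

Lemma ipC x y : ip x y = ip y x.
Proof. by rewrite /ip dotC; case: (dot y x). Qed.

Lemma ipDl x y z : ip (x + y) z = ip x z + ip y z.
Proof. by rewrite /ip linearDl ReD. Qed.

Lemma ipNl x z : ip (- x) z = - ip x z.
Proof. by rewrite /ip linearNl ReN. Qed.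

Lemma ipZl a x z : ip (a%:C *: x) z = a * ip x z.
Proof. by rewrite /ip linearZl_LR/= ReCM. Qed.

Lemma ipDr x y z : ip z (x + y) = ip z x + ip z y.
Proof. by rewrite ipC ipDl !(ipC z). Qed.

Lemma ipNr x z : ip z (- x) = - ip z x.
Proof. by rewrite ipC ipNl ipC. Qed.

Lemma ipZr a x z : ip z (a%:C *: x) = a * ip z x.
Proof. by rewrite ipC ipZl ipC. Qed.

Lemma ipBl x y z : ip (x - y) z = ip x z - ip y z.
Proof. by rewrite ipDl ipNl. Qed.

Definition ipE := (ipDl, ipDr, ipNl, ipNr, ipZl, ipZr).

Lemma nrmE x : `|x| = (nrm x)%:C.
Proof. by rewrite /nrm; have := normr_ge0 x; rewrite lecE/=; case: `|x| => a b /= /andP[/eqP->]. Qed.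

Lemma nrm_ge0 x : 0 <= nrm x.
Proof. by rewrite -ler0c -nrmE. Qed.

Lemma sqr_nrm x : nrm x ^+ 2 = ip x x.
Proof. by rewrite /ip -norm_dot nrmE -rmorphXn. Qed.

Lemma ip_ge0 x : 0 <= ip x x.
Proof. by rewrite -sqr_nrm sqr_ge0. Qed.

Lemma nrm_eq0 x : nrm x = 0 -> x = 0.
Proof. by move=> x0; apply/eqP; rewrite -normr_eq0 nrmE x0. Qed.

Lemma nrm0 : nrm 0 = 0.
Proof. by rewrite /nrm normr0. Qed.

Lemma nrmN x : nrm (- x) = nrm x.
Proof. by rewrite /nrm normrN. Qed.

Lemma nrmD x y : nrm (x + y) <= nrm x + nrm y.
Proof. by rewrite -lecR rmorphD/= -!nrmE ler_normD. Qed.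

Lemma nrmB x y : nrm (x - y) <= nrm x + nrm y.
Proof. by rewrite -[nrm y]nrmN nrmD. Qed.

Lemma nrm_distC x y : nrm (x - y) = nrm (y - x).
Proof. by rewrite -nrmN opprB. Qed.

Lemma nrmZ a x : nrm (a%:C *: x) = `|a| * nrm x.
Proof.
apply/(@complexI R); rewrite -nrmE normrZ nrmE rmorphM/=; congr (_ * _).
by rewrite normc_def/= expr0n/= addr0 sqrtr_sqr.
Qed.

Lemma nrm_sum I (s : seq I) (F : I -> H) :
  nrm (\sum_(i <- s) F i) <= \sum_(i <- s) nrm (F i).
Proof.
elim: s => [|i s IH]; first by rewrite !big_nil nrm0.
by rewrite !big_cons (le_trans (nrmD _ _))// lerD2l.
Qed.

Lemma normalize x : x != 0 -> nrm ((nrm x)^-1%:C *: x) = 1.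
Proof.
move=> x0; have n0 : nrm x != 0 by apply: contra_neq x0; exact: nrm_eq0.
by rewrite nrmZ ger0_norm ?invr_ge0 ?nrm_ge0// mulVf.
Qed.

Lemma bopD_app A B x : (A + B) x = A x + B x. Proof. by []. Qed.
Lemma bopN_app A x : (- A) x = - A x. Proof. exact: scaleN1r. Qed.
Lemma bopB_app A B x : (A - B) x = A x - B x.
Proof. by rewrite bopD_app bopN_app. Qed.
Lemma bopM_app A B x : (A * B) x = A (B x). Proof. by []. Qed.
Lemma bopZ_app (k : R[i]) A x : (k *: A) x = k *: A x. Proof. by []. Qed.
Lemma bop1_app x : (1 : bop H) x = x. Proof. by []. Qed.
Lemma bop0_app x : (0 : bop H) x = 0. Proof. by []. Qed.
Definition bop_appE :=
  (bopB_app, bopD_app, bopN_app, bopM_app, bopZ_app, bop1_app, bop0_app).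

Lemma ip_sum I (s : seq I) (F : I -> H) y :
  ip (\sum_(i <- s) F i) y = \sum_(i <- s) ip (F i) y.
Proof.
elim: s => [|i s IH]; first by rewrite !big_nil /ip linear0l.
by rewrite !big_cons ipDl IH.
Qed.

Lemma bop_sum_app I (s : seq I) (F : I -> bop H) x :
  (\sum_(i <- s) F i) x = \sum_(i <- s) F i x.
Proof.
elim: s => [|i s IH]; first by rewrite !big_nil.
by rewrite !big_cons bop_appE IH.
Qed.

Lemma bopZl (k : R[i]) A B : (k *: A) * B = k *: (A * B).
Proof. exact: bopP. Qed.
Lemma bopZr (k : R[i]) A B : A * (k *: B) = k *: (A * B).
Proof. by apply: bopP => x; rewrite !bop_appE linearZ. Qed.

Definition op_le_norm A c := forall x, nrm (A x) <= c * nrm x.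

Lemma op_bound A : exists2 c, 0 <= c & op_le_norm A c.
Proof.
have [c c0 Ac] := bop_bound A; exists c => // x.
by have := Ac x; rewrite !nrmE -rmorphM lecR.
Qed.

Definition sa A := forall x y, ip (A x) y = ip x (A y).
Definition psd A := forall x, 0 <= ip (A x) x.

Lemma sa1 : sa 1. Proof. by []. Qed.
Lemma sa0 : sa 0. Proof. by move=> x y; rewrite !bop_appE /ip linear0l linear0r. Qed.
Lemma saD A B : sa A -> sa B -> sa (A + B).
Proof. by move=> sA sB x y; rewrite !bop_appE !ipE sA sB. Qed.
Lemma saN A : sa A -> sa (- A).
Proof. by move=> sA x y; rewrite !bop_appE !ipE sA. Qed.
Lemma saB A B : sa A -> sa B -> sa (A - B).
Proof. by move=> sA sB; apply: saD => //; exact: saN. Qed.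
Lemma saZ a A : sa A -> sa (a%:C *: A).
Proof. by move=> sA x y; rewrite !bop_appE !ipE sA. Qed.
Lemma saM A B : sa A -> sa B -> A * B = B * A -> sa (A * B).
Proof. by move=> sA sB AB x y; rewrite {2}AB !bop_appE sA sB. Qed.
Lemma sa_conj A B : sa A -> sa B -> sa (B * A * B).
Proof. by move=> sA sB x y; rewrite !bop_appE sB sA sB. Qed.
Lemma saX A n : sa A -> sa (A ^+ n).
Proof.
move=> sA; elim: n => [|n IH]; first by rewrite expr0; exact: sa1.
by rewrite exprS; apply: saM => //; rewrite -exprS exprSr.
Qed.

(** Real symmetry yields complex symmetry because the operators are
    complex linear: imaginary parts are read off at [i x]. *)
Lemma sa_selfadjoint A : sa A <-> bop_selfadjoint dot A.
Proof.
split=> [sA x y|sA x y]; last by rewrite /ip sA.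
have Im_dot u v : Im (dot u v) = - ip ('i *: u) v.
  by rewrite /ip linearZl_LR/=; case: (dot u v) => ? ? /=; rewrite mul0r mul1r sub0r opprK.
apply/eqP; rewrite eq_complex -!/(ip _ _) !Im_dot sA eqxx/=.
by rewrite -linearZ sA eqxx.
Qed.

Lemma psd_bop_le A B : sa A -> sa B -> (psd (B - A) <-> bop_le dot A B).
Proof.
move=> sA sB; have /sa_selfadjoint sBA : sa (B - A) by exact: saB.
split=> [h x|h x]; last by have := h x; rewrite lecE => /andP[].
rewrite lecE; apply/andP; split; last exact: h.
have := dotC ((B - A) x) x; rewrite -sBA => /eqP.
case: (dot _ _) => u v /=; rewrite eq_complex/= => /andP[_].
by rewrite -subr_eq0 opprK -mulr2n mulrn_eq0.
Qed.

Lemma discriminant a b c : (forall t, 0 <= a + 2 * t * b + t ^+ 2 * c) ->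
  b ^+ 2 <= a * c.
Proof.
move=> h; have a0 : 0 <= a by have := h 0; rewrite !(mulr0, mul0r, expr0n, addr0).
have c0 : 0 <= c.
  rewrite leNgt; apply/negP => c0.
  have cN0 : c != 0 by rewrite lt_eqF.
  (* adding the values at [t] and [- t] removes the linear term *)
  pose t := (a + b ^+ 2 + 1) / - c + 1; have t1 : 1 <= t.
    by rewrite lerDr divr_ge0 ?oppr_ge0 ?(ltW c0)// !addr_ge0// sqr_ge0.
  have := h t; have := h (- t) => h1 h2.
  have : 0 <= a + t ^+ 2 * c by nra.
  have tc : t * c = - (a + b ^+ 2 + 1) + c by rewrite /t; field.
  have : t ^+ 2 * c <= - (a + b ^+ 2 + 1).
    rewrite expr2 -mulrA tc; nra.
  by have := sqr_ge0 b; lra.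
have [c_0|cN0] := eqVneq c 0.
  have [->|bN0] := eqVneq b 0; first by rewrite c_0 mulr0 expr0n.
  have := h (- (a + 1) / (2 * b)); rewrite c_0 mulr0 addr0.
  have -> : 2 * (- (a + 1) / (2 * b)) * b = - (a + 1) by field.
  lra.
have := h (- b / c).
have -> : a + 2 * (- b / c) * b + (- b / c) ^+ 2 * c = a - b ^+ 2 / c by field.
by rewrite subr_ge0 ler_pdivrMr// lt_def cN0.
Qed.

Lemma psd_cauchy_schwarz A x y : sa A -> psd A ->
  ip (A x) y ^+ 2 <= ip (A x) x * ip (A y) y.
Proof.
move=> sA pA; apply: discriminant => t.
have := pA (x + t%:C *: y); rewrite linearD linearZ !ipE (sA y x) (ipC y).
by move=> /le_trans -> //; rewrite le_eqVlt; apply/orP; left; apply/eqP; ring.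
Qed.

Lemma cauchy_schwarz x y : `|ip x y| <= nrm x * nrm y.
Proof.
rewrite -(@ler_pXn2r _ 2) ?nnegrE ?mulr_ge0 ?nrm_ge0// exprMn !sqr_nrm.
rewrite real_normK ?num_real//.
by apply: (@psd_cauchy_schwarz 1) => // z; exact: ip_ge0.
Qed.

(** The Cauchy-Schwarz inequality of the form of [A] at the vectors [x] and
    [A x]. *)
Lemma psd_sqr_le A c x : sa A -> psd A -> op_le_norm A c ->
  nrm (A x) ^+ 2 <= c * ip (A x) x.
Proof.
move=> sA pA Ac; set v := A x; have [v0|v0] := eqVneq (nrm v) 0.
  have /nrm_eq0 -> : nrm v = 0 by [].
  by rewrite nrm0 /ip linear0l mulr0 expr0n.
have vp : 0 < nrm v by rewrite lt_def v0 nrm_ge0.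
have := psd_cauchy_schwarz x v sA pA; rewrite -/v -sqr_nrm => h.
have h2 : ip (A v) v <= c * nrm v ^+ 2.
  apply: le_trans (ler_norm _) _; apply: le_trans (cauchy_schwarz _ _) _.
  by rewrite expr2 mulrA ler_wpM2r ?nrm_ge0.
have := le_trans h (ler_wpM2l (pA x) h2); rewrite -/v => {}h.
rewrite -(ler_pM2r (exprn_gt0 2 vp)) -expr2.
by rewrite [leRHS](_ : _ = ip v x * (c * nrm v ^+ 2)); last by ring.
Qed.

(** * Positivity of polynomials in a self-adjoint operator *)

Lemma poly_bop_widen p A n : (size p <= n)%N ->
  poly_bop p A = \sum_(i < n) (p`_i)%:C *: A ^+ i.
Proof.
move=> pn; rewrite /poly_bop (big_ord_widen n (fun i => (p`_i)%:C *: A ^+ i))//.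
rewrite [RHS](bigID (fun i : 'I_n => (i < size p)%N))/= [X in _ + X]big1 ?addr0//.
by move=> i; rewrite -leqNgt => /(nth_default _) ->; rewrite scale0r.
Qed.

Lemma poly_bopD p q A : poly_bop (p + q) A = poly_bop p A + poly_bop q A.
Proof.
pose n := maxn (size p) (size q).
rewrite !(@poly_bop_widen _ _ n) ?leq_maxl ?leq_maxr ?size_polyD//.
by rewrite -big_split; apply: eq_bigr => i _; rewrite coefD rmorphD scalerDl.
Qed.

Lemma poly_bopC c A : poly_bop c%:P A = c%:C *: (1 : bop H).
Proof.
by rewrite (@poly_bop_widen _ _ 1) ?size_polyC_leq1// big_ord1 coefC expr0.
Qed.

Lemma poly_bopMX p A : poly_bop (p * 'X) A = A * poly_bop p A.
Proof.
rewrite (@poly_bop_widen _ _ (size p).+1); last first.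
  by have [->|p0] := eqVneq p 0; rewrite ?mul0r ?size_poly0// size_mulX.
rewrite big_ord_recl coefMX scale0r add0r mulr_sumr.
by apply: eq_bigr => i _; rewrite coefMX/= exprS bopZr.
Qed.

Lemma poly_bopM p q A : poly_bop (p * q) A = poly_bop p A * poly_bop q A.
Proof.
elim/poly_ind: p => [|p c IH]; first by rewrite mul0r -[0]/(0%:P) poly_bopC scale0r mul0r.
have CM c' q' : poly_bop (c'%:P * q') A = c'%:C *: poly_bop q' A.
  elim/poly_ind: q' => [|q' d IHd].
    by rewrite mulr0 -[0]/(0%:P) poly_bopC scale0r scaler0.
  rewrite mulrDr mulrA !poly_bopD !poly_bopMX IHd -polyCM !poly_bopC.
  by rewrite scalerDr bopZr scalerA rmorphM.
rewrite mulrDl mulrAC !poly_bopD !poly_bopMX CM IH poly_bopC mulrDl mulrA.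
by rewrite bopZl mul1r.
Qed.

Lemma poly_bopX A : poly_bop 'X A = A.
Proof. by rewrite -['X]mul1r -[1]/(1%:P) poly_bopMX poly_bopC scale1r mulr1. Qed.

Lemma poly_bopN p A : poly_bop (- p) A = - poly_bop p A.
Proof.
rewrite -[in LHS]mulN1r -[-1 in LHS]/(- (1%:P)) -polyCN poly_bopM poly_bopC.
by rewrite bopZl mul1r rmorphN rmorph1 scaleN1r.
Qed.

Lemma poly_bopB p q A : poly_bop (p - q) A = poly_bop p A - poly_bop q A.
Proof. by rewrite poly_bopD poly_bopN. Qed.

Lemma sa_poly_bop p A : sa A -> sa (poly_bop p A).
Proof.
move=> sA; rewrite /poly_bop; elim/big_ind: _ => //; first exact: sa0.
- exact: saD.
- by move=> i _; apply: saZ; exact: saX.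
Qed.

Definition bounded_below A := exists2 c, 0 < c & forall x, c * nrm x <= nrm (A x).

Lemma bounded_belowM A B :
  bounded_below A -> bounded_below B -> bounded_below (A * B).
Proof.
move=> [a a0 Aa] [b b0 Bb]; exists (a * b) => [|x]; first by rewrite mulr_gt0.
by rewrite -mulrA (le_trans _ (Aa _))// ler_wpM2l// ltW.
Qed.

Lemma invertible_bounded_below A : bop_invertible A -> bounded_below A.
Proof.
move=> [B [_ BA]]; have [c c0 Bc] := op_bound B.
exists (c + 1)^-1 => [|x]; first by rewrite invr_gt0 ltr_wpDl.
rewrite mulrC ler_pdivrMr ?ltr_wpDl// mulrC.
rewrite -[in leLHS](bop1_app x) -BA bop_appE (le_trans (Bc _))//.
by rewrite ler_wpM2r ?nrm_ge0// lerDl.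
Qed.

Lemma coercive_bounded_below A c : 0 < c ->
  (forall x, c * ip x x <= ip (A x) x) -> bounded_below A.
Proof.
move=> c0 Ac; exists c => // x; have [->|x0] := eqVneq x 0.
  by rewrite linear0 !nrm0 mulr0.
have nx0 : 0 < nrm x.
  by rewrite lt_def nrm_ge0 andbT; apply: contra_neq x0; exact: nrm_eq0.
rewrite -(ler_pM2r nx0) -mulrA -expr2 sqr_nrm.
apply: le_trans (Ac x) _; apply: le_trans (ler_norm _) _; exact: cauchy_schwarz.
Qed.

(** Real polynomials split into linear factors and quadratic ones without real
    root; the latter are always bounded below at a self-adjoint operator. *)
Lemma poly_bounded_below p A : sa A -> p != 0 ->
  (forall t, root p t -> bounded_below (A - t%:C *: (1 : bop H))) ->
  bounded_below (poly_bop p A).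
Proof.
move=> sA; have [n] := ubnP (size p); elim: n p => // n IH p pn p0 pA.
have [p1|p1] := leqP (size p) 1.
  rewrite (size1_polyC p1) poly_bopC.
  have c0 : p`_0 != 0.
    by apply: contra_neq p0 => c0; rewrite (size1_polyC p1) c0.
  exists `|p`_0|; first by rewrite normr_gt0.
  by move=> x; rewrite bop_appE nrmZ.
have factor d q : p = q * d -> (1 < size d)%N ->
    bounded_below (poly_bop d A) -> bounded_below (poly_bop p A).
  move=> pqd d1 dA; have /andP[q0 d0] : (q != 0) && (d != 0).
    by rewrite -negb_or -mulf_eq0 -pqd.
  rewrite pqd poly_bopM; apply: bounded_belowM => //; apply: IH => //.
    move: pn; rewrite pqd size_mul//.
    case: (size d) d1 => [|[|k]]// _; rewrite !addnS/= ltnS.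
    exact: leq_ltn_trans (leq_addr _ _).
  by move=> t qt; apply: pA; rewrite pqd rootM qt.
pose pC := map_poly (real_complex R) p.
have [z pz] : exists z : R[i], root pC z.
  by apply: closed_rootP; rewrite size_map_poly gtn_eqF.
have pzE : pC.[z] = 0 by apply/eqP.
case: z pz pzE => u v pz pzE; have [v0|v0] := eqVneq v 0.
  have pu : root p u.
    by move: pz; rewrite v0 complexr0 fmorph_root.
  have [q pq] := factor_theorem _ _ pu.
  apply: (factor _ _ pq); first by rewrite size_XsubC.
  by rewrite poly_bopB poly_bopX poly_bopC; exact: pA.
pose d : {poly R} := ('X - u%:P) ^+ 2 + (v ^+ 2)%:P.
have sd : size d = 3.
  by rewrite size_polyDl ?size_polyC size_exp_XsubC// (leq_ltn_trans (leq_b1 _)).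
have dz : (map_poly (real_complex R) d).[u +i* v] = 0.
  rewrite /d rmorphD rmorphXn rmorphB/= map_polyX !map_polyC/= !hornerE.
  by apply/eqP; rewrite eq_complex/=; apply/andP; split; apply/eqP; ring.
have d0 : d != 0 by rewrite -size_poly_gt0 sd.
have dvd : modp p d = 0.
  have := divp_eq p d => /(congr1 (map_poly (real_complex R))).
  rewrite rmorphD rmorphM => /(congr1 (fun P => P.[u +i* v])).
  rewrite hornerD hornerM dz mulr0 add0r -/pC pzE.
  have sm : (size (modp p d) <= 2)%N by have := ltn_modp p d; rewrite d0 sd ltnS.
  move: (modp p d) sm => m sm /esym.
  have -> : m = m`_1 *: 'X + (m`_0)%:P.
    apply/polyP => -[|[|i]]; rewrite !coefE ?mulr0 ?add0r ?mulr1 ?addr0//.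
    by rewrite nth_default// (leq_trans sm).
  rewrite rmorphD/= map_polyZ/= map_polyX map_polyC/= !hornerE.
  move/eqP; rewrite eq_complex/= => /andP[/eqP h1 /eqP h2].
  have m1 : m`_1 = 0.
    apply/eqP; have /eqP : m`_1 * v = 0 by rewrite -[RHS]h2; ring.
    by rewrite mulf_eq0 (negbTE v0) orbF.
  have m0 : m`_0 = 0 by rewrite -[RHS]h1 m1; ring.
  by rewrite m1 m0 scale0r addr0.
apply: (factor d (divp p d)); last 2 first.
- by rewrite sd.
- apply: (@coercive_bounded_below _ (v ^+ 2)) => [|x].
    by rewrite lt_def sqr_ge0 andbT expf_neq0.
  rewrite poly_bopD expr2 poly_bopM poly_bopC poly_bopB poly_bopX poly_bopC.
  set S := A - _; have sS : sa S by apply: saB => //; exact: saZ.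
  move: S sS => S sS; rewrite !bop_appE ipDl ipZl sS lerDr; exact: ip_ge0.
- by rewrite [LHS](divp_eq p d) dvd addr0.
Qed.

(** For a self-adjoint operator this is the real spectrum; asking only for a
    failure of boundedness below avoids any question of surjectivity. *)
Definition approx_spectrum A t := ~ bounded_below (A - t%:C *: (1 : bop H)).

Lemma approx_spectrum_sub A t : approx_spectrum A t -> spectrum A t%:C.
Proof. by move=> h /invertible_bounded_below. Qed.

(** With [l] the infimum of the numerical range, [A - l] is positive, and
    [psd_sqr_le] turns unit vectors where its form is small into approximate
    eigenvectors. *)
Lemma inf_numerical_range A : sa A -> (exists x : H, x != 0) ->
  exists l, (forall x, l * ip x x <= ip (A x) x) /\
    ~ bounded_below (A - l%:C *: (1 : bop H)).
Proof.
move=> sA [x0 x0N0]; have [c c0 Ac] := op_bound A.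
pose E : set R := [set ip (A x) x | x in [set x | nrm x = 1]]%classic.
have E0 : (E !=set0)%classic.
  by exists (ip (A ((nrm x0)^-1%:C *: x0)) ((nrm x0)^-1%:C *: x0));
    exists ((nrm x0)^-1%:C *: x0) => //; exact: normalize.
have Elb : lbound E (- c).
  move=> _ [x /= x1 <-]; have := cauchy_schwarz (A x) x.
  rewrite ler_norml => /andP[h _]; apply: le_trans h; rewrite lerN2 x1 mulr1.
  by rewrite (le_trans (Ac x))// x1 mulr1.
have hE : has_inf E by split => //; exists (- c).
have lE x : inf E * ip x x <= ip (A x) x.
  have [->|xN0] := eqVneq x 0; first by rewrite linear0 /ip linear0l mulr0.
  have n0 : 0 < nrm x.
    by rewrite lt_def nrm_ge0 andbT; apply: contra_neq xN0; exact: nrm_eq0.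
  have : inf E <= ip (A ((nrm x)^-1%:C *: x)) ((nrm x)^-1%:C *: x).
    apply: ge_inf; first by case: hE.
    by exists ((nrm x)^-1%:C *: x) => //; exact: normalize.
  rewrite linearZ !ipE mulrA -invfM mulrC -expr2 sqr_nrm.
  by rewrite ler_pdivlMr// -sqr_nrm exprn_gt0.
exists (inf E); split=> // -[d d0 dA].
set Y := A - _ in dA.
have sY : sa Y by apply: saB => //; exact: saZ.
have pY : psd Y.
  by move=> x; rewrite /Y !bop_appE ipBl ipZl subr_ge0.
have [y y0 Yy] := op_bound Y.
have dy : 0 < d ^+ 2 / (y + 1) by rewrite divr_gt0 ?exprn_gt0// ltr_wpDl.
have [_ [x /= x1 <-] xE] := inf_adherent dy hE.
have h1 : ip (Y x) x < d ^+ 2 / (y + 1).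
  by rewrite /Y !bop_appE ipBl ipZl -sqr_nrm x1 expr1n mulr1 ltrBlDl.
have h2 := psd_sqr_le x sY pY Yy.
have h3 := dA x; rewrite x1 mulr1 in h3.
have h4 : d ^+ 2 <= nrm (Y x) ^+ 2 by rewrite ler_pXn2r ?nnegrE ?nrm_ge0// ltW.
move: h1; rewrite ltr_pdivlMr ?ltr_wpDl// mulrC => h1.
have := pY x; lra.
Qed.

(** The infimum [l] of the numerical range of [p(A)] is an approximate
    eigenvalue, hence [p - l] must have a root in the approximate spectrum of
    [A], and there [p] takes the value [l]. *)
Lemma psd_poly_bop p A : sa A ->
  (forall t, approx_spectrum A t -> 0 <= p.[t]) -> psd (poly_bop p A).
Proof.
move=> sA pA x.
have [->|xN0] := eqVneq x 0; first by rewrite linear0 /ip linear0l.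
have nz : exists x : H, x != 0 by exists x.
have [l [lp nb]] := inf_numerical_range (sa_poly_bop p sA) nz.
suff l0 : 0 <= l by rewrite (le_trans _ (lp x))// mulr_ge0// ip_ge0.
have [pl|plN0] := eqVneq (p - l%:P) 0.
  have [t [_ /pA]] := inf_numerical_range sA nz.
  by rewrite -[p](subrK l%:P) pl add0r hornerC.
rewrite leNgt; apply/negP => l0; apply: nb.
have -> : poly_bop p A - l%:C *: (1 : bop H) = poly_bop (p - l%:P) A.
  by rewrite poly_bopB poly_bopC.
apply: poly_bounded_below => // t; rewrite /root hornerD hornerN hornerC subr_eq0.
move=> /eqP ptl; apply: contrapT => /pA; rewrite ptl leNgt l0.
by [].
Qed.
End Hilbert.

(** * Continuous functional calculus *)

Section Completeness.
Context {R : realType} {H : completeNormedModType R[i]}.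
Implicit Types (x y : H) (e : R).

Lemma bop_cauchy_limit (U : nat -> bop H) (u : nat -> R) :
  (forall e, 0 < e -> exists n0, forall n, (n0 <= n)%N -> u n <= e) ->
  (forall n k, (n <= k)%N -> op_le_norm (U n - U k) (u n)) ->
  exists T : bop H, forall n, op_le_norm (U n - T) (u n).
Proof.
move=> u0 Uu.
have Unk n k x : (n <= k)%N -> nrm (U n x - U k x) <= u n * nrm x.
  by move=> nk; have := Uu _ _ nk x; rewrite bop_appE.
have small x e : 0 < e -> exists n, u n * nrm x <= e.
  move=> e0; have [|n h] := u0 (e / (nrm x + 1)).
    by rewrite divr_gt0// ltr_wpDl// nrm_ge0.
  exists n; apply: le_trans (ler_wpM2r (nrm_ge0 x) (h n (leqnn n))) _.
  rewrite mulrAC ler_pdivrMr ?ltr_wpDl ?nrm_ge0// ler_wpM2l ?(ltW e0)//.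
  by rewrite lerDl.
have Ucvg x : cvgn (fun n => U n x).
  apply: cauchy_cvg; apply: cauchy_exP => e; rewrite ltcE/= => /andP[/eqP e1 e0].
  have e0' : 0 < complex.Re e / 2 by rewrite divr_gt0.
  have [n nx] := small x _ e0'.
  exists (U n x); exists n => // k /= nk.
  rewrite -ball_normE/= nrmE [e]complexE e1 mulr0 addr0 ltcR.
  apply: le_lt_trans (Unk _ _ _ nk) _; apply: le_lt_trans nx _.
  by rewrite ltr_pdivrMr// ltr_pMr// ltr1n.
pose T x := limn (fun n => U n x).
have lT : linear T.
  move=> a x y; apply/cvg_lim => //.
  rewrite (_ : (fun n => U n (a *: x + y)) = (fun n => a *: U n x + U n y)).
    by apply: cvgD; [apply: cvgZr; exact: Ucvg|exact: Ucvg].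
  by apply/funext => n; rewrite linearP.
have UT n x : nrm (U n x - T x) <= u n * nrm x.
  apply/ler_addgt0Pr => e e0.
  have /cvgrPdist_le/(_ e%:C) := Ucvg x; rewrite ltcR => /(_ e0)[k _ kP].
  pose j := maxn n k.
  have -> : U n x - T x = (U n x - U j x) + (U j x - T x).
    by rewrite addrA subrK.
  apply: le_trans (nrmD _ _) _; apply: lerD; first by rewrite Unk// leq_maxl.
  have := kP j (leq_maxr _ _); rewrite /= nrmE lecR nrm_distC.
  exact.
have bT : exists c : R, forall x, `|T x| <= c%:C * `|x|.
  have [c c0 Uc] := op_bound (U 0%N); exists (c + u 0%N) => x.
  rewrite !nrmE -rmorphM lecR mulrDl.
  have -> : T x = U 0%N x - (U 0%N x - T x) by rewrite opprB addrC subrK.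
  by apply: le_trans (nrmB _ _) _; exact: lerD.
by exists (Bop lT bT) => n x; rewrite bop_appE; exact: UT.
Qed.

End Completeness.

Section FunctionalCalculus.
Context {R : realType} {H : completeNormedModType R[i]}.
Context (dot : {dot H for Num.conj}).
Context (norm_dot : forall x : H, `|x| ^+ 2 = dot x x).
Implicit Types (x y z : H) (B S T : bop H) (p q : {poly R}) (c e t : R).
Implicit Types (f g : R -> R).

Local Notation ip := (ip dot).
Local Notation sa := (sa dot).
Local Notation psd := (psd dot).

(** [e^2 - p^2] is nonnegative on the approximate spectrum. *)
Lemma poly_bop_norm p (A : bop H) e : sa A -> 0 <= e ->
  (forall t, approx_spectrum A t -> `|p.[t]| <= e) ->
  op_le_norm (poly_bop p A) e.
Proof.
move=> sA e0 pe x.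
have h : psd (poly_bop ((e ^+ 2)%:P - p * p) A).
  apply: psd_poly_bop => // t /pe pt.
  rewrite !hornerE subr_ge0 -expr2 -(real_normK (num_real p.[t])).
  by rewrite ler_pXn2r// nnegrE.
have := h x; rewrite poly_bopB poly_bopM poly_bopC !bop_appE !ipE.
rewrite (sa_poly_bop p sA) -!(sqr_nrm norm_dot) subr_ge0 -exprMn.
by rewrite ler_pXn2r// nnegrE ?nrm_ge0// mulr_ge0// nrm_ge0.
Qed.

Context (A : bop H) (a b : R) (sA : sa A) (ab : a < b).
Context (A_ge : forall x, a * ip x x <= ip (A x) x).
Context (A_le : forall x, ip (A x) x <= b * ip x x).

Lemma approx_spectrum_segment t : approx_spectrum A t -> a <= t <= b.
Proof.
move=> At; apply/andP; split; rewrite leNgt; apply/negP => tab; apply: At.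
  apply: (@coercive_bounded_below _ _ dot norm_dot _ (a - t)) => [|x].
    by rewrite subr_gt0.
  by rewrite !bop_appE !ipE mulrBl lerD2r.
suff [c c0 cP] : bounded_below (- (A - t%:C *: (1 : bop H))).
  by exists c => // x; have := cP x; rewrite bopN_app nrmN.
apply: (@coercive_bounded_below _ _ dot norm_dot _ (t - b)) => [|x].
  by rewrite subr_gt0.
by rewrite !bop_appE !ipE mulrBl opprB lerD2l lerN2.
Qed.

(** Approximation on the whole segment, and not only on the spectrum: that the
    spectrum lies in the segment is itself deduced from this calculus. *)
Definition fc f T := forall e, 0 < e -> exists p,
  on_segment a b (fun t => `|p.[t] - f t| <= e) /\ op_le_norm (poly_bop p A - T) e.

Lemma fc_exists f : lip_on a b f -> exists T, fc f T.
Proof.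
move=> lf; have e0 n : 0 < (n.+1%:R : R)^-1 by rewrite invr_gt0 ltr0n.
have [p pP] := choice (fun n => lip_approx ab lf (e0 n)).
have [||T TP] := @bop_cauchy_limit _ _ (fun n => poly_bop (p n) A)
    (fun n => n.+1%:R^-1 * 2).
- move=> e ep; exists (Num.truncn (e / 2)^-1) => n hn.
  rewrite -ler_pdivlMr// invf_ple ?posrE ?ltr0n ?divr_gt0//.
  apply: ltW; apply: lt_le_trans (truncnS_gt _) _.
  by rewrite ler_nat ltnS.
- move=> n k nk; rewrite -poly_bopB; apply: poly_bop_norm => //.
  move=> t /approx_spectrum_segment tab; rewrite hornerD hornerN.
  have -> : (p n).[t] - (p k).[t] = ((p n).[t] - f t) - ((p k).[t] - f t).
    by ring.
  apply: le_trans (ler_normB _ _) _; rewrite mulr_natr mulr2n.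
  apply: lerD; first exact: pP.
  by apply: le_trans (pP k t tab) _; rewrite lef_pV2 ?posrE ?ltr0n// ler_nat.
exists T => e ep; pose n := Num.truncn (e / 2)^-1.
have ne : n.+1%:R^-1 * 2 <= e.
  rewrite -ler_pdivlMr// invf_ple ?posrE ?ltr0n ?divr_gt0//.
  by apply: ltW; exact: truncnS_gt.
exists (p n); split.
  move=> t tab; apply: le_trans (pP n t tab) _; apply: le_trans ne.
  by rewrite ler_pMr// ler1n.
by move=> x; apply: le_trans (TP n x) _; rewrite ler_wpM2r// nrm_ge0.
Qed.

Definition cfc f := xget 0 [set T | fc f T]%classic.

Lemma cfcP f : lip_on a b f -> fc f (cfc f).
Proof. by move=> /fc_exists[T fT]; apply: (@xgetPex _ 0 [set S | fc f S]%classic); exists T. Qed.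

Lemma fc_dist f g S T e : fc f S -> fc g T -> 0 <= e ->
  on_segment a b (fun t => `|f t - g t| <= e) -> op_le_norm (S - T) e.
Proof.
move=> fS gT e0 fg x; rewrite bop_appE; apply/ler_addgt0Pr => d d0.
pose h := d / (4 * (nrm x + 1)).
have n1 : 0 < nrm x + 1 by rewrite ltr_wpDl// nrm_ge0.
have h0 : 0 < h by rewrite divr_gt0// mulr_gt0.
have [p [pf pS]] := fS _ h0; have [q [qg qT]] := gT _ h0.
have pq : op_le_norm (poly_bop (p - q) A) (e + 2 * h).
  apply: poly_bop_norm => //; first by rewrite addr_ge0// mulr_ge0// ltW.
  move=> t /approx_spectrum_segment tab; rewrite hornerD hornerN.
  have -> : p.[t] - q.[t] = (p.[t] - f t) + (f t - g t) - (q.[t] - g t) by ring.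
  apply: le_trans (ler_normB _ _) _.
  apply: (@le_trans _ _ (h + e + h)); last by lra.
  apply: lerD; last exact: qg.
  by apply: le_trans (ler_normD _ _) _; apply: lerD; [exact: pf|exact: fg].
have -> : S x - T x =
    (poly_bop (p - q) A) x - (poly_bop p A - S) x + (poly_bop q A - T) x.
  have telescope (u v w : H) : u - v - (u - w) = w - v.
    by rewrite opprB addrC addrA subrK.
  by rewrite poly_bopB !bop_appE telescope addrA subrK.
apply: (@le_trans _ _ ((e + 2 * h) * nrm x + h * nrm x + h * nrm x)).
  apply: le_trans (nrmD _ _) _; apply: lerD; last exact: qT.
  by apply: le_trans (nrmB _ _) _; apply: lerD; [exact: pq|exact: pS].
have -> : (e + 2 * h) * nrm x + h * nrm x + h * nrm x = e * nrm x + 4 * h * nrm x.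
  by ring.
rewrite lerD2l (_ : 4 * h * nrm x = d * (nrm x / (nrm x + 1))); last first.
  by rewrite /h; field; rewrite gt_eqF.
by rewrite ler_piMr ?(ltW d0)// ler_pdivrMr// mul1r lerDl.
Qed.

Lemma op_le_norm0 T : op_le_norm T 0 -> T = 0.
Proof.
move=> T0; apply: bopP => x; apply: nrm_eq0; apply/eqP.
by rewrite eq_le nrm_ge0 andbT -(mul0r (nrm x)).
Qed.

Lemma fc_eq f g S T : fc f S -> fc g T ->
  on_segment a b (fun t => f t = g t) -> S = T.
Proof.
move=> fS gT fg; apply/eqP; rewrite -subr_eq0; apply/eqP; apply: op_le_norm0.
by apply: fc_dist fS gT _ _ => // t tab; rewrite fg// subrr normr0.
Qed.

Lemma cfc_eq f T : lip_on a b f -> fc f T -> cfc f = T.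
Proof. by move=> /cfcP fS fT; apply: fc_eq fS fT _. Qed.

Lemma cfc_ext f g : lip_on a b f -> on_segment a b (fun t => f t = g t) ->
  cfc f = cfc g.
Proof.
move=> lf fg; have lg := lip_ext fg lf.
by apply: fc_eq (cfcP lf) (cfcP lg) fg.
Qed.

Lemma cfc_poly p : lip_on a b (horner p) -> cfc (horner p) = poly_bop p A.
Proof.
move=> lp; apply: cfc_eq => // e e0; exists p; split=> [t _|x].
  by rewrite subrr normr0 ltW.
by rewrite subrr bop_appE nrm0 mulr_ge0 ?nrm_ge0// ltW.
Qed.

Lemma cfc_cst c : cfc (fun=> c) = c%:C *: (1 : bop H).
Proof.
rewrite -(poly_bopC c A) -cfc_poly.
  by apply: cfc_ext => [|t _]; [exact: lip_cst|rewrite hornerC].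
by apply: lip_ext (lip_cst _ _ c) => t _; rewrite hornerC.
Qed.

Lemma cfc_id : cfc id = A.
Proof.
rewrite -[RHS]poly_bopX -cfc_poly.
  by apply: cfc_ext => [|t _]; [exact: lip_id|rewrite hornerX].
by apply: lip_ext (lip_id _ _) => t _; rewrite hornerX.
Qed.

Lemma cfcD f g : lip_on a b f -> lip_on a b g ->
  cfc (fun t => f t + g t) = cfc f + cfc g.
Proof.
move=> lf lg; apply: cfc_eq => [|e e0]; first exact: lip_add.
have e2 : 0 < e / 2 by rewrite divr_gt0.
have [p [pf pS]] := cfcP lf e2; have [q [qg qT]] := cfcP lg e2.
exists (p + q); split=> [t tab|x].
  rewrite hornerD opprD addrACA [e]splitr.
  by apply: le_trans (ler_normD _ _) _; apply: lerD; [exact: pf|exact: qg].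
rewrite poly_bopD opprD addrACA bop_appE [e in leRHS]splitr mulrDl.
by apply: le_trans (nrmD _ _) _; apply: lerD; [exact: pS|exact: qT].
Qed.

Lemma cfcM f g : lip_on a b f -> lip_on a b g ->
  cfc (fun t => f t * g t) = cfc f * cfc g.
Proof.
move=> lf lg; apply: cfc_eq => [|e e0]; first exact: lip_mul.
have [F F0 fF] := lip_bounded lf; have [G G0 gG] := lip_bounded lg.
have [N N0 SN] := op_bound (cfc f); have [K K0 TK] := op_bound (cfc g).
pose h := Num.min 1 (e / (F + G + 1 + N + K + 1)).
have h0 : 0 < h by rewrite lt_min ltr01/= divr_gt0// ltr_wpDl// !addr_ge0.
have h1 : h <= 1 by rewrite ge_min lexx.
have he : h * (F + G + 1 + N + K + 1) <= e.
  rewrite -ler_pdivlMr; first by rewrite ge_min lexx orbT.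
  by rewrite ltr_wpDl// !addr_ge0.
have hh : h * h <= h by rewrite ger_pMr.
have [p [pf pS]] := cfcP lf h0; have [q [qg qT]] := cfcP lg h0.
have hF : 0 <= h * F by rewrite mulr_ge0// ltW.
have hG : 0 <= h * G by rewrite mulr_ge0// ltW.
have hN : 0 <= h * N by rewrite mulr_ge0// ltW.
have hK : 0 <= h * K by rewrite mulr_ge0// ltW.
exists (p * q); split=> [t tab|x].
  rewrite hornerM.
  have -> : p.[t] * q.[t] - f t * g t = (p.[t] - f t) * (q.[t] - g t) +
      (p.[t] - f t) * g t + f t * (q.[t] - g t) by ring.
  apply: (@le_trans _ _ (h * h + h * G + F * h)); last by lra.
  apply: le_trans (ler_normD _ _) _; apply: lerD.
    apply: le_trans (ler_normD _ _) _; rewrite !normrM.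
    by apply: lerD; rewrite ler_pM ?pf ?qg ?gG.
  by rewrite normrM ler_pM ?qg ?fF.
rewrite poly_bopM.
set P := poly_bop p A in pS *; set Q := poly_bop q A in qT *.
set S := cfc f in SN pS *; set T := cfc g in TK qT *.
have PN y : nrm (P y) <= (h + N) * nrm y.
  have -> : P y = (P - S) y + S y by rewrite bop_appE subrK.
  by rewrite mulrDl (le_trans (nrmD _ _))// lerD// (pS, SN).
have -> : P * Q - S * T = P * (Q - T) + (P - S) * T.
  by rewrite mulrBr mulrBl addrA subrK.
have x0 := nrm_ge0 x.
apply: (@le_trans _ _ ((h * h + h * N + h * K) * nrm x)); last first.
  by rewrite ler_wpM2r//; lra.
rewrite bopD_app [leRHS]mulrDl; apply: le_trans (nrmD _ _) _; apply: lerD.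
  apply: le_trans (PN _) _; rewrite -mulrDr [h * _]mulrC -mulrA.
  by apply: ler_wpM2l; [lra|exact: qT].
apply: le_trans (pS _) _; rewrite -mulrA ler_wpM2l ?(ltW h0)//; exact: TK.
Qed.

Lemma cfcZ c f : lip_on a b f -> cfc (fun t => c * f t) = c%:C *: cfc f.
Proof.
move=> lf; rewrite cfcM//; last exact: lip_cst.
by rewrite cfc_cst bopZl mul1r.
Qed.

Lemma cfcB f g : lip_on a b f -> lip_on a b g ->
  cfc (fun t => f t - g t) = cfc f - cfc g.
Proof.
move=> lf lg; rewrite cfcD//; last exact: lip_opp.
congr (_ + _); rewrite -[RHS]scaleN1r -(rmorphN1 (real_complex R)) -cfcZ//.
by apply: cfc_ext => [|t _]; [exact: lip_opp|rewrite mulN1r].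
Qed.

Lemma cfcC f g : lip_on a b f -> lip_on a b g -> cfc f * cfc g = cfc g * cfc f.
Proof.
move=> lf lg; rewrite -!cfcM//.
by apply: cfc_ext => [|t _]; [exact: lip_mul|rewrite mulrC].
Qed.

Lemma cfc_sum n (F : nat -> R -> R) : (forall k, lip_on a b (F k)) ->
  cfc (fun t => \sum_(i < n) F i t) = \sum_(i < n) cfc (F i).
Proof.
move=> lF.
have lS k : lip_on a b (fun t => \sum_(i < k) F i t).
  elim: k => [|k IH].
    by apply: lip_ext (lip_cst a b 0) => t _; rewrite big_ord0.
  by apply: lip_ext (lip_add IH (lF k)) => t _; rewrite big_ord_recr.
elim: n => [|n IH].
  rewrite big_ord0; have := cfc_cst 0; rewrite scale0r => <-.
  by apply: (cfc_ext (lS _)) => t _; rewrite big_ord0.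
rewrite big_ord_recr/= -IH -cfcD//.
by apply: (cfc_ext (lS _)) => t _; rewrite big_ord_recr.
Qed.

Lemma sa_cfc f : lip_on a b f -> sa (cfc f).
Proof.
move=> lf x y; apply/eqP; rewrite -subr_eq0 -normr_le0; apply/ler_addgt0Pr => e e0.
have n0 : 0 < 2 * (nrm x * nrm y) + 1.
  by rewrite ltr_wpDl// !mulr_ge0// nrm_ge0.
have [|p [_ pS]] := cfcP lf (_ : 0 < e / (2 * (nrm x * nrm y) + 1)).
  by rewrite divr_gt0.
set S := cfc f in pS *; set h := _ / _ in pS.
have -> : ip (S x) y - ip x (S y) =
    ip x ((poly_bop p A - S) y) - ip ((poly_bop p A - S) x) y.
  by rewrite !bop_appE !ipE (sa_poly_bop p sA); ring.
rewrite add0r; apply: le_trans (ler_normB _ _) _.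
apply: (@le_trans _ _ (nrm x * (h * nrm y) + h * nrm x * nrm y)).
  apply: lerD; apply: le_trans (cauchy_schwarz norm_dot _ _) _.
    by rewrite ler_wpM2l ?nrm_ge0//; exact: pS.
  by rewrite ler_wpM2r ?nrm_ge0//; exact: pS.
have -> : nrm x * (h * nrm y) + h * nrm x * nrm y =
    e * (2 * (nrm x * nrm y) / (2 * (nrm x * nrm y) + 1)).
  by rewrite /h; field; rewrite gt_eqF.
by rewrite ler_piMr ?(ltW e0)// ler_pdivrMr// mul1r lerDl.
Qed.

(** A function with values in [[0, F]] is within [F / 2] of the constant
    [F / 2]. *)
Lemma psd_cfc f : lip_on a b f -> on_segment a b (fun t => 0 <= f t) ->
  psd (cfc f).
Proof.
move=> lf f0; have [F F0 fF] := lip_bounded lf.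
have lc := lip_cst a b (F / 2).
have F2 : 0 <= F / 2 by rewrite divr_ge0.
have := @fc_dist _ _ _ _ (F / 2) (cfcP lf) (cfcP lc) F2.
have h : on_segment a b (fun t => `|f t - F / 2| <= F / 2).
  move=> t tab; have := f0 t tab; have := fF t tab.
  by rewrite !ler_norml => /andP[_ ? ?]; apply/andP; split; lra.
move=> /(_ h) {}h x; have := cauchy_schwarz norm_dot ((cfc f - cfc (fun=> F / 2)) x) x.
rewrite ler_norml cfc_cst => /andP[h1 _].
have h2 : F / 2 * ip x x >= nrm ((cfc f - cfc (fun=> F / 2)) x) * nrm x.
  by rewrite -(sqr_nrm norm_dot) expr2 mulrA ler_wpM2r ?nrm_ge0//; exact: h.
move: h1 h2; rewrite cfc_cst !bop_appE !ipE; lra.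
Qed.

Lemma cfc_le f g x : lip_on a b f -> lip_on a b g ->
  on_segment a b (fun t => f t <= g t) -> ip (cfc f x) x <= ip (cfc g x) x.
Proof.
move=> lf lg fg; have h : psd (cfc (fun t => g t - f t)).
  by apply: psd_cfc => [|t /fg]; [exact: lip_sub|rewrite subr_ge0].
by have := h x; rewrite cfcB// bop_appE ipBl subr_ge0.
Qed.

Lemma cfc_inverse f c : 0 < c -> lip_on a b f ->
  on_segment a b (fun t => c <= `|f t|) ->
  cfc f * cfc (fun t => (f t)^-1) = 1 /\ cfc (fun t => (f t)^-1) * cfc f = 1.
Proof.
move=> c0 lf cf; have li := lip_inv c0 cf lf.
suff E : cfc f * cfc (fun t => (f t)^-1) = 1 by split=> //; rewrite cfcC.
rewrite -cfcM// -[RHS]scale1r -cfc_cst.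
apply: cfc_ext => [|t /cf h]; first exact: lip_mul.
by rewrite divff// -normr_gt0 (lt_le_trans c0).
Qed.

(** Outside of the segment the calculus provides the resolvent, as the image of
    [1 / (u - t)]. *)
Lemma spectrum_segment t : spectrum A t%:C -> a <= t <= b.
Proof.
move=> At; apply: contrapT => tab; apply: At.
have [d d0 dP] : exists2 d, 0 < d & on_segment a b (fun u => d <= `|u - t|).
  have [ta|ta] := ltP t a.
    exists (a - t) => [|x /andP[ax _]]; first by rewrite subr_gt0.
    by rewrite ger0_norm ?lerD2r// subr_ge0 (le_trans (ltW ta)).
  have [tb|bt] := leP t b; first by case: tab; rewrite ta.
  exists (t - b) => [|x /andP[_ xb]]; first by rewrite subr_gt0.
  by rewrite distrC ger0_norm ?lerD2l ?lerN2// subr_ge0 (le_trans xb)// ltW.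
have ld : lip_on a b (fun u => u - t) by apply: lip_sub (lip_id _ _) (lip_cst _ _ _).
have [h1 h2] := cfc_inverse d0 ld dP; exists (cfc (fun u => (u - t)^-1)).
have E : cfc (fun u => u - t) = A - t%:C *: (1 : bop H).
  rewrite cfcB ?cfc_cst; last exact: lip_cst; last exact: lip_id.
  by congr (_ - _); exact: cfc_id.
by rewrite -E.
Qed.

(** The polynomials approximate [f] on the spectrum only; their difference is
    small there, and [poly_bop_norm] involves nothing else. *)
Lemma is_fc_unique f S T :
  is_functional_calculus A f S -> is_functional_calculus A f T -> S = T.
Proof.
move=> [p [pf pS]] [q [qf qT]]; apply/eqP; rewrite -subr_eq0; apply/eqP.
apply: bopP => x; rewrite bop0_app; apply: nrm_eq0; apply/eqP.
rewrite eq_le nrm_ge0 andbT; apply/ler_addgt0Pr => e e0; rewrite add0r.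
pose h := e / (4 * (nrm x + 1)).
have n1 : 0 < nrm x + 1 by rewrite ltr_wpDl// nrm_ge0.
have h0 : 0 < h by rewrite divr_gt0// mulr_gt0.
have [n [[[pn pSn] qn] qTn]] := filter_ex
  (filterI (filterI (filterI (pf _ h0) (pS _ h0)) (qf _ h0)) (qT _ h0)).
have {}pSn : op_le_norm (poly_bop (p n) A - S) h.
  by move=> y; have := pSn y; rewrite !nrmE -rmorphM lecR.
have {}qTn : op_le_norm (poly_bop (q n) A - T) h.
  by move=> y; have := qTn y; rewrite !nrmE -rmorphM lecR.
have pq : op_le_norm (poly_bop (p n - q n) A) (2 * h).
  apply: poly_bop_norm => // [|t /approx_spectrum_sub At].
    by rewrite mulr_ge0// ltW.
  rewrite hornerD hornerN.
  have -> : (p n).[t] - (q n).[t] = ((p n).[t] - f t) - ((q n).[t] - f t) by ring.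
  apply: le_trans (ler_normB _ _) _; rewrite [2 * h]mulr_natl mulr2n.
  by apply: lerD; [exact: pn|exact: qn].
have -> : (S - T) x = (poly_bop (p n - q n) A) x - (poly_bop (p n) A - S) x +
    (poly_bop (q n) A - T) x.
  have telescope (u v w : H) : u - v - (u - w) = w - v.
    by rewrite opprB addrC addrA subrK.
  by rewrite poly_bopB !bop_appE telescope addrA subrK.
apply: (@le_trans _ _ (2 * h * nrm x + h * nrm x + h * nrm x)).
  apply: le_trans (nrmD _ _) _; apply: lerD; last exact: qTn.
  by apply: le_trans (nrmB _ _) _; apply: lerD; [exact: pq|exact: pSn].
have -> : 2 * h * nrm x + h * nrm x + h * nrm x = e * (nrm x / (nrm x + 1)).
  by rewrite /h; field; rewrite gt_eqF.
by rewrite ler_piMr ?(ltW e0)// ler_pdivrMr// mul1r lerDl.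
Qed.

Lemma functional_calculusE f : lip_on a b f -> functional_calculus A f = cfc f.
Proof.
move=> lf; have fP : is_functional_calculus A f (cfc f).
  have e0 n : 0 < (n.+1%:R : R)^-1 by rewrite invr_gt0 ltr0n.
  have [p pP] := choice (fun n => cfcP lf (e0 n)).
  exists p; split=> e ep; exists (Num.truncn e^-1) => // n /= hn.
    move=> t /spectrum_segment tab; apply: le_trans ((pP n).1 t tab) _.
    rewrite invf_ple ?posrE ?ltr0n//; apply: ltW.
    by apply: lt_le_trans (truncnS_gt _) _; rewrite ler_nat ltnS.
  move=> x; rewrite !nrmE -rmorphM lecR; apply: le_trans ((pP n).2 x) _.
  rewrite ler_wpM2r ?nrm_ge0// invf_ple ?posrE ?ltr0n//; apply: ltW.
  by apply: lt_le_trans (truncnS_gt _) _; rewrite ler_nat ltnS.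
apply: (is_fc_unique _ fP).
by apply: (@xgetPex _ 0 (is_functional_calculus A f)); exists (cfc f).
Qed.

End FunctionalCalculus.

(** * Operators that vanish to first order along the whole spectrum *)

Section Core.
Context {R : realType} {H : completeNormedModType R[i]}.
Context (dot : {dot H for Num.conj}).
Context (norm_dot : forall x : H, `|x| ^+ 2 = dot x x).
Implicit Types (x y : H) (S T : bop H) (c e s t u K : R) (f g q : R -> R).

Local Notation ip := (ip dot).
Local Notation sa := (sa dot).
Local Notation psd := (psd dot).

Context (A : bop H) (a b : R) (sA : sa A) (ab : a < b).
Context (A_ge : forall x, a * ip x x <= ip (A x) x).
Context (A_le : forall x, ip (A x) x <= b * ip x x).

Local Notation cfc := (cfc A a b).
Local Notation lip := (lip_on a b).

(** The tents [ramp (u + 1) - ramp u], with [u] shifted by integers, form a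
    partition of unity whose partial sums telescope. *)
Definition ramp u := Num.min 1 (Num.max 0 u).

Lemma ramp_ge1 u : 1 <= u -> ramp u = 1.
Proof. by move=> u1; rewrite /ramp max_r ?(le_trans ler01)// min_l. Qed.

Lemma ramp_le0 u : u <= 0 -> ramp u = 0.
Proof. by move=> u0; rewrite /ramp max_l// min_r. Qed.

Lemma ramp_itv u : 0 <= ramp u <= 1.
Proof. by rewrite /ramp le_min ler01 le_max lexx ge_min lexx. Qed.

Lemma lip_ramp f : lip f -> lip (fun t => ramp (f t)).
Proof.
by move=> lf; apply: lip_min (lip_cst _ _ _) (lip_max (lip_cst _ _ _) lf).
Qed.

Lemma tent_itv u : 0 <= ramp (u + 1) - ramp u <= 1.
Proof.
have /andP[h1 h2] := ramp_itv u; have /andP[h3 h4] := ramp_itv (u + 1).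
have [u0|u0] := leP u 0; first by rewrite (ramp_le0 u0) subr0 h3.
rewrite ramp_ge1 ?lerDr ?(ltW u0)//.
by rewrite subr_ge0 h2 gerBl h1.
Qed.

Lemma tent_sqr_le u :
  (u * (ramp (u + 1) - ramp u)) ^+ 2 <= ramp (u + 1) - ramp u.
Proof.
have [u1|u1] := leP u (-1).
  by rewrite !ramp_le0 ?subrr ?mulr0 ?expr0n//; lra.
have [u2|u2] := leP 1 u.
  by rewrite !ramp_ge1 ?subrr ?mulr0 ?expr0n//; lra.
have /andP[h0 h1] := tent_itv u; set h := _ - _ in h0 h1 *.
have uu : u ^+ 2 <= 1 by nra.
rewrite exprMn; apply: (@le_trans _ _ (1 * h ^+ 2)); last by nra.
by rewrite ler_wpM2r// sqr_ge0.
Qed.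

Lemma sqr_sum_le n (F : 'I_n -> R) :
  (\sum_(i < n) F i) ^+ 2 <= n%:R * \sum_(i < n) F i ^+ 2.
Proof.
rewrite mulrC; apply: discriminant => t.
have -> : \sum_(i < n) F i ^+ 2 + 2 * t * (\sum_(i < n) F i) + t ^+ 2 * n%:R =
    \sum_(i < n) (F i + t) ^+ 2.
  have -> : n%:R = \sum_(i < n) 1 :> R by rewrite sumr_const card_ord.
  rewrite !mulr_sumr -!big_split.
  by apply: eq_bigr => i _ /=; ring.
by apply: sumr_ge0 => i _; exact: sqr_ge0.
Qed.

Lemma nrm_cfc f x : lip f -> nrm (cfc f x) ^+ 2 = ip (cfc (fun t => f t ^+ 2) x) x.
Proof.
move=> lf; rewrite (sqr_nrm norm_dot) (sa_cfc norm_dot)//.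
rewrite (@ipC _ _ _ x) -bopM_app -(cfcM norm_dot)//.
Qed.

Lemma cfc_shift s : cfc (fun t => t - s) = A - s%:C *: (1 : bop H).
Proof.
rewrite (cfcB norm_dot sA ab A_ge A_le (lip_id a b) (lip_cst a b s)).
by rewrite (cfc_cst norm_dot)// (cfc_id norm_dot).
Qed.

Lemma lip_shift s : lip (fun t => t - s).
Proof. by apply: lip_sub (lip_id _ _) (lip_cst _ _ _). Qed.

(** A spectral piece of width [w] around [s] is mapped by [T] to a vector of
    size [O(w)] times its norm. The vector [q(A) x] is cut into [n = O(1 / w)]
    pieces; the triangle inequality for the images costs a factor [n^(1/2)]
    with respect to the root of the sum of squares, but the pieces are almost
    orthogonal, so the total is [O(w n^(1/2))], which tends to 0. *)
Lemma first_order_vanishing T L c q : 0 <= L -> a < c ->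
  (forall s, a <= s <= c -> forall x, nrm (T x) <= L * nrm ((A - s%:C *: (1 : bop H)) x)) ->
  lip q -> on_segment a b (fun t => c < t -> q t = 0) -> T * cfc q = 0.
Proof.
move=> L0 ac TL lq q0; have [Q Q0 qQ] := lip_bounded lq.
apply: bopP => x; rewrite bop0_app bop_appE; apply: nrm_eq0; apply/eqP.
rewrite -sqrf_eq0 eq_le sqr_ge0 andbT.
pose K := 2 * (L * (c - a) * Q * nrm x) ^+ 2.
have K0 : 0 <= K by rewrite mulr_ge0// sqr_ge0.
suff main n : nrm (T (cfc q x)) ^+ 2 <= K / n.+1%:R.
  apply/ler_addgt0Pr => e e0; rewrite add0r.
  apply: le_trans (main (Num.truncn (K / e))) _.
  rewrite ler_pdivrMr ?ltr0n// mulrC -ler_pdivrMr//.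
  by apply: ltW; exact: truncnS_gt.
(* [h k] is the tent of half-width [w] centred at [sk k]; on [[a, c]] the ramp
   [r 0] is 1 and the ramp [r N.+1] is 0 *)
pose N := n.+1; pose w := (c - a) / N%:R.
have N0 : 0 < N%:R :> R by rewrite ltr0n.
have w0 : 0 < w by rewrite divr_gt0// subr_gt0.
pose r k t := ramp ((t - a) / w + 1 - k%:R).
pose h (k : nat) t := r k t - r k.+1 t.
pose sk (k : nat) := a + k%:R * w.
have hE k t : h k t = ramp ((t - sk k) / w + 1) - ramp ((t - sk k) / w).
  rewrite /h /r -natr1; congr (ramp _ - ramp _).
    by rewrite /sk; field; rewrite gt_eqF.
  by rewrite /sk; field; rewrite gt_eqF.
have lr k : lip (r k).
  apply: lip_ramp; apply: lip_sub (lip_cst _ _ _).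
  apply: lip_add (lip_cst _ _ _).
  exact: lip_mul (lip_shift a) (lip_cst _ _ _).
have lh k : lip (h k) by apply: lip_sub.
have lhq k : lip (fun t => h k t * q t) by apply: lip_mul.
have lg k : lip (fun t => (t - sk k) * (h k t * q t)).
  exact: lip_mul (lip_shift _) _.
have partition t : a <= t <= b -> q t = \sum_(k < N.+1) h k t * q t.
  move=> tab; rewrite -mulr_suml.
  have -> : \sum_(k < N.+1) h k t = r 0%N t - r N.+1 t.
    rewrite -[RHS]opprB -(telescope_sumr (fun k => r k t) (leq0n N.+1)) big_mkord.
    by rewrite -sumrN; apply: eq_bigr => k _; rewrite opprB.
  have [ct|tc] := ltP c t; first by rewrite q0// mulr0.
  have /andP[at_ _] := tab.
  rewrite /r ramp_ge1; last first.
    by rewrite subr0 lerDr divr_ge0 ?subr_ge0// ltW.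
  rewrite ramp_le0 ?subr0 ?mul1r// -natr1 opprD addrA addrAC addrK subr_le0.
  by rewrite ler_pdivrMr// /w mulrC divfK ?gt_eqF// lerD2r.
have qE : cfc q = \sum_(k < N.+1) cfc (fun t => h k t * q t).
  rewrite -(@cfc_sum _ _ _ norm_dot _ _ _ sA ab A_ge A_le _ (fun k t => h k t * q t))//.
  exact: (cfc_ext norm_dot).
have TE : T (cfc q x) = \sum_(k < N.+1) T (cfc (fun t => h k t * q t) x).
  by rewrite qE bop_sum_app linear_sum.
pose m (k : 'I_N.+1) := nrm (cfc (fun t => (t - sk k) * (h k t * q t)) x).
have Tm : nrm (T (cfc q x)) <= L * \sum_(k < N.+1) m k.
  rewrite TE mulr_sumr; apply: le_trans (nrm_sum _ _) _; apply: ler_sum => k _.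
  have sk_itv : a <= sk k <= c.
    rewrite /sk lerDl mulr_ge0 ?ler0n ?(ltW w0)//= -lerBrDl.
    by rewrite /w mulrCA ger_pMr ?subr_gt0// ler_pdivrMr// mul1r ler_nat -ltnS.
  apply: le_trans (TL _ sk_itv _) _; rewrite ler_wpM2l//.
  by rewrite -cfc_shift -bopM_app -(cfcM norm_dot)//; exact: lip_shift.
have mm : \sum_(k < N.+1) m k ^+ 2 <= (w * Q) ^+ 2 * nrm x ^+ 2.
  have -> : \sum_(k < N.+1) m k ^+ 2 =
      ip (cfc (fun t => \sum_(k < N.+1) ((t - sk k) * (h k t * q t)) ^+ 2) x) x.
    rewrite (@cfc_sum _ _ _ norm_dot _ _ _ sA ab A_ge A_le _
      (fun k t => ((t - sk k) * (h k t * q t)) ^+ 2)); last first.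
      by move=> k; apply: lip_mul.
    by rewrite bop_sum_app ip_sum; apply: eq_bigr => k _; rewrite nrm_cfc.
  have -> : (w * Q) ^+ 2 * nrm x ^+ 2 = ip (cfc (fun=> (w * Q) ^+ 2) x) x.
    by rewrite (cfc_cst norm_dot)// !bop_appE ipZl (sqr_nrm norm_dot).
  apply: (cfc_le norm_dot) => //; [|exact: lip_cst|].
    have : forall k, lip (fun t => ((t - sk k) * (h k t * q t)) ^+ 2).
      by move=> k; apply: lip_mul.
    move: N.+1 => k lk; elim: k => [|k IH].
      by apply: lip_ext (lip_cst a b 0) => t _; rewrite big_ord0.
    by apply: lip_ext (lip_add IH (lk k)) => t _; rewrite big_ord_recr.
  move=> t tab.
  apply: (@le_trans _ _ (\sum_(k < N.+1) (w * Q) ^+ 2 * h k t)).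
    apply: ler_sum => k _.
    have -> : ((t - sk k) * (h k t * q t)) ^+ 2 =
        w ^+ 2 * (q t ^+ 2 * ((t - sk k) / w * h k t) ^+ 2).
      by field; rewrite gt_eqF.
    rewrite [leRHS](_ : _ = w ^+ 2 * (Q ^+ 2 * h k t)); last by ring.
    rewrite ler_wpM2l ?sqr_ge0// ler_pM ?sqr_ge0//.
      by rewrite -(real_normK (num_real _)) ler_pXn2r ?nnegrE ?qQ.
    by rewrite hE; exact: tent_sqr_le.
  rewrite -mulr_sumr ler_piMr ?sqr_ge0//.
  rewrite -[leLHS]opprK -sumrN (eq_bigr (fun k : 'I_N.+1 => r k.+1 t - r k t)); last first.
    by move=> k _; rewrite opprB.
  rewrite -(big_mkord xpredT (fun k => r k.+1 t - r k t)) telescope_sumr// opprB.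
  have /andP[h1 h2] := ramp_itv ((t - a) / w + 1 - 0%:R).
  have /andP[h3 h4] := ramp_itv ((t - a) / w + 1 - N.+1%:R).
  by rewrite /r; lra.
have m0 : 0 <= \sum_(k < N.+1) m k by apply: sumr_ge0 => k _; exact: nrm_ge0.
apply: (@le_trans _ _ ((L * \sum_(k < N.+1) m k) ^+ 2)).
  by rewrite ler_pXn2r ?nnegrE ?nrm_ge0// mulr_ge0.
rewrite exprMn; apply: (@le_trans _ _ (L ^+ 2 * (N.+1%:R * ((w * Q) ^+ 2 * nrm x ^+ 2)))).
  rewrite ler_wpM2l ?sqr_ge0//; apply: le_trans (sqr_sum_le _) _.
  by rewrite ler_wpM2l ?ler0n.
have -> : L ^+ 2 * (N.+1%:R * ((w * Q) ^+ 2 * nrm x ^+ 2)) =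
    (L * (c - a) * Q * nrm x) ^+ 2 / N%:R * (N.+1%:R / N%:R).
  by rewrite /w; field; rewrite gt_eqF.
have -> : K / n.+1%:R = (L * (c - a) * Q * nrm x) ^+ 2 / N%:R * 2.
  by rewrite /K /N; field; rewrite gt_eqF.
rewrite ler_wpM2l ?divr_ge0 ?sqr_ge0 ?ler0n//.
by rewrite ler_pdivrMr// -natrM ler_nat /N; lia.
Qed.

(** A form bounded by the square of [A - s] is bounded by [A - s] as an
    operator, by the Cauchy-Schwarz inequality for [T + K (A - s)^2]. *)
Lemma form_to_norm T K : sa T -> 0 <= K -> exists2 L, 0 <= L &
  forall s, a <= s <= b ->
    (forall x, `|ip (T x) x| <= K * nrm ((A - s%:C *: (1 : bop H)) x) ^+ 2) ->
  forall x, nrm (T x) <= L * nrm ((A - s%:C *: (1 : bop H)) x).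
Proof.
move=> sT K0; have [N N0 TN] := op_bound T; have [G G0 AG] := op_bound A.
pose D := G + (`|a| + `|b|); have D0 : 0 <= D by rewrite !addr_ge0.
pose Y0 := N + K * D * D; have Y00 : 0 <= Y0 by rewrite addr_ge0// !mulr_ge0.
exists (Num.sqrt (2 * K * Y0) + K * D) => [|s sab TK x].
  by rewrite addr_ge0 ?sqrtr_ge0 ?mulr_ge0.
set S := A - _ in TK *.
have sS : sa S by apply: saB => //; apply: saZ; exact: sa1.
have SD : op_le_norm S D.
  move=> y; rewrite /S !bop_appE; apply: le_trans (nrmB _ _) _.
  rewrite mulrDl; apply: lerD => //; rewrite nrmZ ler_wpM2r ?nrm_ge0//.
  move: sab => /andP[sa_ sb]; rewrite ler_norml.
  have := ler_norm b; have := ler_norm (- a); rewrite normrN.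
  have := normr_ge0 a; have := normr_ge0 b => ? ? ? ?.
  by apply/andP; split; lra.
move: S sS SD TK => S sS SD TK.
pose Y := T + K%:C *: (S * S).
have sY : sa Y by apply: saD => //; apply: saZ; exact: saM.
have YE y : ip (Y y) y = ip (T y) y + K * nrm (S y) ^+ 2.
  by rewrite /Y !bop_appE ipDl ipZl sS (sqr_nrm norm_dot).
have pY : psd Y.
  move=> y; rewrite YE; have := TK y; rewrite ler_norml => /andP[h _].
  by rewrite -lerBlDr sub0r.
have SSD y : nrm (S (S y)) <= D * nrm (S y) by exact: SD.
have YY : op_le_norm Y Y0.
  move=> y; rewrite /Y !bop_appE mulrDl; apply: le_trans (nrmD _ _) _.
  apply: lerD => //; rewrite nrmZ ger0_norm// -!mulrA ler_wpM2l//.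
  by apply: le_trans (SSD y) _; rewrite ler_wpM2l.
have TE : T x = Y x - K%:C *: S (S x) by rewrite /Y !bop_appE addrK.
rewrite TE mulrDl; apply: le_trans (nrmB _ _) _; apply: lerD; last first.
  by rewrite nrmZ ger0_norm// -mulrA ler_wpM2l.
rewrite -(@ler_pXn2r _ 2) ?nnegrE ?mulr_ge0 ?nrm_ge0 ?sqrtr_ge0// exprMn sqr_sqrtr ?mulr_ge0//.
apply: le_trans (psd_sqr_le norm_dot x sY pY YY) _; rewrite YE.
have := TK x; rewrite ler_norml => /andP[_ h].
rewrite [leRHS](_ : _ = Y0 * (K * nrm (S x) ^+ 2 + K * nrm (S x) ^+ 2)); last by ring.
by rewrite ler_wpM2l// lerD2r.
Qed.
End Core.

(** * Characterising the power by its tangents *)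

Section TangentBounds.
Context {R : realType} {H : completeNormedModType R[i]}.
Context (dot : {dot H for Num.conj}).
Context (norm_dot : forall x : H, `|x| ^+ 2 = dot x x).
Implicit Types (x y : H) (S T : bop H) (c e s t u K : R) (f g q : R -> R).

Local Notation ip := (ip dot).
Local Notation sa := (sa dot).
Local Notation psd := (psd dot).

(** The form of [F] is nonnegative at [Fi x - Xi x]. *)
Lemma antitone_inverse X Xi F Fi : sa X -> sa F -> psd F ->
    X * Xi = 1 -> F * Fi = 1 ->
    (forall x, ip (F x) x <= ip (X x) x) ->
  forall x, ip (Xi x) x <= ip (Fi x) x.
Proof.
move=> sX sF pF XXi FFi FX x; set y := Xi x; set z := Fi x.
have Xy : X y = x by rewrite /y -bopM_app XXi.
have Fz : F z = x by rewrite /z -bopM_app FFi.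
have Fyz : ip (F y) z = ip x y by rewrite sF Fz (@ipC _ _ _ y).
have := FX y; have := pF (z - y).
rewrite linearB /= !ipE Fz Xy Fyz (@ipC _ _ _ y x) (@ipC _ _ _ z x); lra.
Qed.

Context (A : bop H) (a b r : R) (sA : sa A) (a0 : 0 < a) (ab : a < b).
Context (r1 : 1 < r).
Context (A_ge : forall x, a * ip x x <= ip (A x) x).
Context (A_le : forall x, ip (A x) x <= b * ip x x).

Local Notation cfc := (cfc A a b).
Local Notation lip := (lip_on a b).

Context (X Xi : bop H) (sX : sa X) (sXi : sa Xi).
Context (XXi : X * Xi = 1) (XiX : Xi * X = 1).
Context (X_ge : forall s, 0 < s -> forall x,
  ip (cfc (fun t => pow_tangent r s t) x) x <= ip (X x) x).
Context (Xi_ge : forall s, 0 < s -> forall x,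
  ip (cfc (fun t => pow_tangent r s t^-1) x) x <= ip (Xi x) x).

Let lip_pow : lip (fun t => t `^ r). Proof. exact: lip_powR. Qed.

Let pow_ge t : a <= t <= b -> a `^ r <= `|t `^ r|.
Proof.
move=> /andP[at_ tb]; rewrite ger0_norm ?powR_ge0//.
by rewrite ge0_ler_powR// ?nnegrE ?(le_trans _ at_) ?(ltW a0)// ltW// (lt_trans ltr01).
Qed.

Let ar0 : 0 < a `^ r. Proof. exact: powR_gt0. Qed.

Let lip_powV : lip (fun t => (t `^ r)^-1).
Proof. exact: lip_inv ar0 _ lip_pow. Qed.

Let powV_cancel : cfc (fun t => t `^ r) * cfc (fun t => (t `^ r)^-1) = 1.
Proof.
by have [] := cfc_inverse norm_dot sA ab A_ge A_le ar0 lip_pow pow_ge.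
Qed.

Let lip_inv_id : lip (fun t => t^-1).
Proof.
apply: (lip_inv a0 _ (lip_id _ _)) => t /andP[at_ _].
by rewrite ger0_norm// (le_trans (ltW a0)).
Qed.

Let lip_sqr_shift s : lip (fun t => (t - s) ^+ 2).
Proof. by apply: lip_mul; exact: lip_shift. Qed.

Let lip_tangent s : lip (pow_tangent r s).
Proof.
apply: lip_add (lip_cst _ _ _).
exact: lip_mul (lip_cst _ _ _) (lip_id _ _).
Qed.

Let lip_tangent_inv s : lip (fun t => pow_tangent r s t^-1).
Proof.
apply: lip_add (lip_cst _ _ _).
exact: lip_mul (lip_cst _ _ _) lip_inv_id.
Qed.

Let T := Xi - cfc (fun t => (t `^ r)^-1).

Let sT : sa T. Proof. by apply: saB => //; exact: (sa_cfc norm_dot sA ab A_ge A_le). Qed.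

Let nrm_shift s x : nrm ((A - s%:C *: (1 : bop H)) x) ^+ 2 =
  ip (cfc (fun t => (t - s) ^+ 2) x) x.
Proof.
rewrite -(cfc_shift norm_dot sA ab A_ge A_le).
by rewrite (nrm_cfc norm_dot)//; exact: lip_shift.
Qed.

(** [Xi] lies above the image of the tangent at [1 / s] in the variable
    [1 / t], and this function has second order contact with [t^(-r)] at
    [t = s]. *)
Lemma inverse_lower_bound : exists2 K, 0 <= K &
  forall s, a <= s <= b -> forall x,
    - (K * ip (cfc (fun t => (t - s) ^+ 2) x) x) <= ip (T x) x.
Proof.
have b0 := lt_trans a0 ab; have r0 := lt_trans ltr01 r1.
have bV0 : 0 < b^-1 by rewrite invr_gt0.
have [K K0 KP] := pow_tangent_approx a^-1 bV0 r0.
have a40 : 0 < a ^+ 4 by rewrite exprn_gt0.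
exists (K / a ^+ 4) => [|s sab x]; first by rewrite divr_ge0// ltW.
have /andP[as_ sb] := sab; have s0 := lt_le_trans a0 as_.
have itvV t : a <= t <= b -> b^-1 <= t^-1 <= a^-1.
  move=> /andP[at_ tb]; have t0 := lt_le_trans a0 at_.
  by rewrite !lef_pV2 ?posrE// at_ tb.
have sV0 : 0 < s^-1 by rewrite invr_gt0.
have lK : lip (fun t => K / a ^+ 4 * (t - s) ^+ 2).
  exact: lip_mul (lip_cst _ _ _) (lip_sqr_shift s).
have := Xi_ge sV0 x; rewrite /T bop_appE ipBl -ipZl -bopZ_app -(cfcZ norm_dot sA ab A_ge A_le)//.
rewrite lerNl opprB => h; rewrite -(lerD2r (ip (Xi x) x)) subrK.
apply: (@le_trans _ _ (ip (cfc (fun t => K / a ^+ 4 * (t - s) ^+ 2) x) x +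
    ip (cfc (fun t => pow_tangent r s^-1 t^-1) x) x)); last by rewrite lerD2l.
rewrite -ipDl -bopD_app -(cfcD norm_dot sA ab A_ge A_le)//.
apply: (cfc_le norm_dot sA ab A_ge A_le) => //; first exact: lip_add.
move=> t tab; have /andP[at_ tb] := tab; have t0 := lt_le_trans a0 at_.
have := KP _ _ (itvV t tab) (itvV s sab).
rewrite powR_Vl//.
rewrite ler_norml => /andP[_]; rewrite lerBlDr => /le_trans; apply.
rewrite lerD2r -mulrA ler_wpM2l//.
have -> : (t^-1 - s^-1) ^+ 2 = (t * s) ^- 2 * (t - s) ^+ 2.
  by field; rewrite !gt_eqF.
rewrite ler_wpM2r ?sqr_ge0// lef_pV2 ?posrE ?exprn_gt0 ?mulr_gt0//.
rewrite (_ : a ^+ 4 = (a * a) ^+ 2); last by ring.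
by rewrite ler_pXn2r ?nnegrE ?mulr_ge0 ?ler_pM// ltW.
Qed.

(** Continuous cut-offs [q] stand for the spectral projection of [A] on the
    values below [c]. *)
Definition vanishes_below c := forall q, lip q ->
  on_segment a b (fun t => c <= t -> q t = 0) -> T * cfc q = 0.

Definition upper_bound_below (P : R -> Prop) := exists2 K, 0 <= K &
  forall s, a <= s <= b -> P s -> forall x,
    ip (T x) x <= K * ip (cfc (fun t => (t - s) ^+ 2) x) x.

(** Together with [inverse_lower_bound] the form of [T] is bounded by
    [(A - s)^2] on both sides. *)
Lemma upper_bound_vanishes c : a < c -> upper_bound_below (fun s => s <= c) ->
  vanishes_below c.
Proof.
move=> ac [K K0 KP] q lq q0; have [K' K'0 K'P] := inverse_lower_bound.
have [L L0 LP] := @form_to_norm _ _ _ norm_dot A a b sA T _ sT (addr_ge0 K0 K'0).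
pose c' := Num.min c b; have ac' : a < c' by rewrite lt_min ac.
apply: (first_order_vanishing norm_dot sA ab A_ge A_le L0 ac') => // [s|t tab].
  rewrite le_min => /andP[as_ /andP[sc sb]]; have sab : a <= s <= b by rewrite as_.
  apply: LP => // x; rewrite nrm_shift ler_norml; apply/andP; split.
    apply: le_trans (K'P s sab x); rewrite lerN2 mulrDl lerDr mulr_ge0//.
    by rewrite -nrm_shift sqr_ge0.
  apply: le_trans (KP s sab sc x) _; rewrite mulrDl lerDl mulr_ge0//.
  by rewrite -nrm_shift sqr_ge0.
by rewrite gt_min => /orP[/ltW|]; [exact: q0|case/andP: tab => _; rewrite leNgt => /negbTE ->].
Qed.

(** The tangent at any [s <= k c] is positive from [c / k] on, its zero being
    at [s (r - 1) / r]. *)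
Let step_ratio k := 1 < k /\ k ^+ 2 * (r - 1) < r.

(** Below [c] the operator [X] agrees with [A^r]. Replacing the tangent there
    by [A^r] itself turns it into a lower bound of [X] that remains positive
    when the point of contact moves up to [k c], and inverting this bound
    estimates [T] from above. *)
Lemma upper_bound_step k c : step_ratio k -> a <= c -> vanishes_below c ->
  upper_bound_below (fun s => c <= s <= k * c).
Proof.
move=> [k1 kr] ac Vc; have c0 := lt_le_trans a0 ac.
have k0 : 0 < k := lt_trans ltr01 k1; have kN0 : k != 0 by rewrite gt_eqF.
have k10 : 0 < k - 1 by rewrite subr_gt0.
have r0 := lt_trans ltr01 r1.
(* a cut-off equal to 1 below [c / k] and to 0 above [c] *)
pose d t := ramp ((1 - t / c) * (k / (k - 1))).
have ld : lip d.
  apply: lip_ramp; apply: lip_mul (lip_cst _ _ _).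
  apply: lip_sub (lip_cst _ _ _) _; exact: lip_mul (lip_id _ _) (lip_cst _ _ _).
have d01 t : 0 <= d t <= 1 by exact: ramp_itv.
have kk10 : 0 < k / (k - 1) by rewrite divr_gt0.
have d_above t : c <= t -> d t = 0.
  move=> ct; apply: ramp_le0; rewrite pmulr_lle0// subr_le0.
  by rewrite ler_pdivlMr// mul1r.
have d_below t : t <= c / k -> d t = 1.
  move=> tc; apply: ramp_ge1; rewrite -ler_pdivrMr// mul1r invf_div.
  rewrite mulrBl divff// mul1r lerD2l lerN2 ler_pdivrMr//.
  by rewrite mulrC.
pose P t := d t * t `^ r.
have lP : lip P by exact: lip_mul.
have XiP : Xi * cfc P = cfc d.
  have : T * cfc P = 0.
    by apply: Vc => // t tab /d_above h; rewrite /P h mul0r.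
  rewrite /T mulrBl -(cfcM norm_dot sA ab A_ge A_le lip_powV lP) => /eqP.
  rewrite subr_eq0 => /eqP ->.
  apply: (cfc_ext norm_dot sA ab A_ge A_le) => [|t /pow_ge tab]; first exact: lip_mul.
  rewrite /P mulrCA mulVf ?mulr1// -normr_gt0.
  exact: lt_le_trans tab.
have Xd : X * cfc d = cfc P by rewrite -XiP mulrA XXi mul1r.
(* [A^r] on the part [1 - (1 - d)^2 = 2 d - d^2], the tangent on the rest; as
   [X] agrees with [A^r] on the range of [d(A)], [X - F(A)] is the compression
   of [X] minus the tangent by [1 - d(A)] *)
pose F s t := t `^ r * (2 * d t - d t ^+ 2) + (1 - d t) ^+ 2 * pow_tangent r s t.
have l1d : lip (fun t => 1 - d t) by apply: lip_sub (lip_cst _ _ _) _.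
have l1d2 : lip (fun t => (1 - d t) ^+ 2) by apply: lip_mul.
have ld2 : lip (fun t => 2 * d t - d t ^+ 2).
  by apply: lip_sub; [exact: lip_mul (lip_cst _ _ _) ld|exact: lip_mul].
have lF1 : lip (fun t => t `^ r * (2 * d t - d t ^+ 2)) by exact: lip_mul.
have lF2 s : lip (fun t => (1 - d t) ^+ 2 * pow_tangent r s t).
  by apply: lip_mul.
have lF s : lip (F s) by apply: lip_add.
have XF s x : 0 < s -> ip (cfc (F s) x) x <= ip (X x) x.
  move=> s0; set v := cfc d x.
  have vE : cfc (fun t => 1 - d t) x = x - v.
    rewrite (cfcB norm_dot sA ab A_ge A_le)//; last exact: lip_cst.
    by rewrite (cfc_cst norm_dot sA ab A_ge A_le)// !bop_appE scale1r.
  have FE2 : ip (cfc (fun t => (1 - d t) ^+ 2 * pow_tangent r s t) x) x =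
      ip (cfc (pow_tangent r s) (x - v)) (x - v).
    rewrite -vE -(sa_cfc norm_dot sA ab A_ge A_le l1d) -!bopM_app.
    rewrite -!(cfcM norm_dot sA ab A_ge A_le)//; last exact: lip_mul.
    congr (ip (bop_fun _ _) _); apply: (cfc_ext norm_dot sA ab A_ge A_le) => // t _; ring.
  have Xv : X v = cfc P x by rewrite /v -bopM_app Xd.
  have FE1 : ip (cfc (fun t => t `^ r * (2 * d t - d t ^+ 2)) x) x =
      2 * ip (X v) x - ip (X v) v.
    rewrite Xv /v -(sa_cfc norm_dot sA ab A_ge A_le ld) -bopM_app.
    rewrite -(cfcM norm_dot sA ab A_ge A_le)// -ipZl -bopZ_app -(cfcZ norm_dot sA ab A_ge A_le)//.
    have l1 : lip (fun t => 2 * P t) by apply: lip_mul (lip_cst _ _ _) _.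
    have l2 : lip (fun t => d t * P t) by apply: lip_mul.
    rewrite -ipBl -bopB_app -(cfcB norm_dot sA ab A_ge A_le)//.
    congr (ip (bop_fun _ _) _).
    by apply: (cfc_ext norm_dot sA ab A_ge A_le) => // t _; rewrite /P; ring.
  rewrite (cfcD norm_dot sA ab A_ge A_le)// bop_appE ipDl FE1 FE2.
  have XE : ip (X (x - v)) (x - v) = ip (X x) x - 2 * ip (X v) x + ip (X v) v.
    by rewrite linearB /= !ipE (sX x v) (@ipC _ _ _ x (X v)); ring.
  by have := X_ge s0 (x - v); rewrite XE; lra.
have eta0 : 0 < (r - k ^+ 2 * (r - 1)) / k by rewrite divr_gt0// subr_gt0.
pose m := Num.min (a `^ r) (a `^ (r - 1) * (a * ((r - k ^+ 2 * (r - 1)) / k))).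
have m0 : 0 < m.
  by rewrite lt_min ar0/=; apply: mulr_gt0; rewrite ?powR_gt0//; exact: mulr_gt0.
have m_tangent s t : c <= s <= k * c -> c / k <= t -> m <= pow_tangent r s t.
  move=> /andP[cs skc] ct; have s0 := lt_le_trans c0 cs.
  rewrite ge_min; apply/orP; right.
  have -> : pow_tangent r s t = s `^ (r - 1) * (r * t - (r - 1) * s).
    by rewrite /pow_tangent -(mulr_powRB1 (ltW s0) r0); ring.
  apply: ler_pM; first exact: powR_ge0.
  - by apply: mulr_ge0; exact: ltW.
  - rewrite ge0_ler_powR ?nnegrE ?(ltW a0) ?(ltW s0) ?(le_trans ac)//.
    by rewrite subr_ge0 ltW.
  apply: (@le_trans _ _ (c * ((r - k ^+ 2 * (r - 1)) / k))).
    by rewrite ler_wpM2r// ltW.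
  have -> : c * ((r - k ^+ 2 * (r - 1)) / k) = r * (c / k) - (r - 1) * (k * c).
    by field.
  apply: lerD; first by rewrite ler_wpM2l// ltW.
  by rewrite lerN2 ler_wpM2l// subr_ge0 ltW.
have mF s t : c <= s <= k * c -> a <= t <= b -> m <= F s t.
  move=> sc tab; have := pow_ge tab; rewrite ger0_norm ?powR_ge0// => at_.
  have mt : m <= t `^ r by rewrite (le_trans _ at_)// ge_min lexx.
  have [tc|ct] := leP t (c / k).
    by rewrite /F d_below//; lra.
  have mp := m_tangent s t sc (ltW ct).
  have /andP[h0 h1] := d01 t.
  have -> : m = m * (2 * d t - d t ^+ 2) + (1 - d t) ^+ 2 * m by ring.
  apply: lerD; last by rewrite ler_wpM2l// sqr_ge0.
  by rewrite ler_wpM2r//; nra.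
have [K K0 KP] := pow_tangent_approx b a0 r0.
exists (K / (m * a `^ r)) => [|s sab sc x]; first by rewrite divr_ge0// mulr_ge0// ltW.
have /andP[as_ sb] := sab; have s0 := lt_le_trans a0 as_.
have mFn : on_segment a b (fun t => m <= `|F s t|).
  by move=> t tab; apply: le_trans (ler_norm _); exact: mF.
have [FFi _] := cfc_inverse norm_dot sA ab A_ge A_le m0 (lF s) mFn.
have lFi := lip_inv m0 mFn (lF s).
have pF : psd (cfc (F s)).
  apply: (psd_cfc norm_dot sA ab A_ge A_le) => // t tab; exact: le_trans (ltW m0) (mF _ _ sc tab).
have := antitone_inverse sX (sa_cfc norm_dot sA ab A_ge A_le (lF s)) pF XXi FFi
  (fun y => XF s y s0) x.
rewrite /T bop_appE ipBl => h; apply: le_trans (lerB h (lexx _)) _.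
rewrite -ipZl -bopZ_app -(cfcZ norm_dot sA ab A_ge A_le)// -ipBl -bopB_app -(cfcB norm_dot sA ab A_ge A_le)//.
apply: (cfc_le norm_dot sA ab A_ge A_le) => //; [exact: lip_sub|exact: lip_mul (lip_cst _ _ _) _|].
move=> t tab; have mt := mF _ _ sc tab; have Ft0 := lt_le_trans m0 mt.
have := pow_ge tab; rewrite ger0_norm ?powR_ge0// => at_.
have tr0 := lt_le_trans ar0 at_.
have -> : (F s t)^-1 - (t `^ r)^-1 =
    (1 - d t) ^+ 2 * (t `^ r - pow_tangent r s t) / (F s t * t `^ r).
  rewrite (_ : (1 - d t) ^+ 2 * _ = t `^ r - F s t); last by rewrite /F; ring.
  by field; rewrite !gt_eqF.
rewrite ler_pdivrMr ?mulr_gt0//.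
apply: (@le_trans _ _ (K * (t - s) ^+ 2)).
  apply: (@le_trans _ _ (1 * `|t `^ r - pow_tangent r s t|)); last by rewrite mul1r KP.
  apply: (@le_trans _ _ ((1 - d t) ^+ 2 * `|t `^ r - pow_tangent r s t|)).
    by rewrite ler_wpM2l ?sqr_ge0// ler_norm.
  rewrite ler_wpM2r//; have /andP[h0 h1] := d01 t.
  by rewrite expr_le1// ?subr_ge0// gerBl.
have -> : K / (m * a `^ r) * (t - s) ^+ 2 * (F s t * t `^ r) =
    K * (t - s) ^+ 2 * (F s t * t `^ r / (m * a `^ r)).
  by field; rewrite !gt_eqF.
apply: ler_peMr; first by apply: mulr_ge0 => //; exact: sqr_ge0.
by rewrite ler_pdivlMr ?mulr_gt0// mul1r ler_pM// ltW.
Qed.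

Lemma bernoulli e n : 0 <= e -> 1 + n%:R * e <= (1 + e) ^+ n.
Proof.
move=> e0; elim: n => [|n IH]; first by rewrite mul0r addr0 expr0.
rewrite exprS; apply: le_trans (ler_wpM2l _ IH); last by rewrite addr_ge0.
rewrite -natr1 -subr_ge0.
have -> : (1 + e) * (1 + n%:R * e) - (1 + (n%:R + 1) * e) = n%:R * e ^+ 2 by ring.
by rewrite mulr_ge0 ?ler0n ?sqr_ge0.
Qed.

(** The windows [[k^n a, k^(n+1) a]] are exhausted one after the other: the upper
    bound on [T] in one window makes [T] vanish below its right end, which
    gives the upper bound in the next one. *)
Theorem eq_pow_of_tangents : X = cfc (fun t => t `^ r).
Proof.
(* any [e > 0] with [(1 + e)^2 < r / (r - 1)] would do *)
have r0 := lt_trans ltr01 r1; pose e := (4 * r)^-1; pose k := 1 + e.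
have r40 : 0 < 4 * r by rewrite mulr_gt0.
have e0 : 0 < e by rewrite invr_gt0.
have e1 : e < 1.
  by rewrite invf_lt1// (lt_le_trans r1)// ler_peMl ?(ltW r0)// ler1n.
have k1 : 1 < k by rewrite ltrDl.
have kr : step_ratio k.
  split=> //; have re : r * e = 4^-1 by rewrite /e; field; rewrite gt_eqF.
  have -> : k ^+ 2 * (r - 1) = r + 2 * (r * e) + (r * e) * e - (1 + 2 * e + e ^+ 2).
    by rewrite /k; ring.
  by rewrite re; have := sqr_ge0 e; lra.
have all_n n : vanishes_below (k ^+ n * a) /\
    upper_bound_below (fun s => s < k ^+ n * a).
  elim: n => [|n [Vn [K1 K10 K1P]]].
    rewrite expr0 mul1r; split=> [q lq q0|].
      have -> : cfc q = cfc (fun=> 0).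
        by apply: (cfc_ext norm_dot sA ab A_ge A_le) => // t tab; apply: q0 => //; case/andP: tab.
      by rewrite (cfc_cst norm_dot sA ab A_ge A_le) scale0r mulr0.
    by exists 0 => // s /andP[as_ _]; rewrite ltNge as_.
  have akn : a <= k ^+ n * a.
    by rewrite ler_peMl ?(ltW a0)// exprn_ege1// ltW.
  have [K2 K20 K2P] := upper_bound_step kr akn Vn.
  have U : upper_bound_below (fun s => s <= k ^+ n.+1 * a).
    exists (K1 + K2) => [|s sab sk x]; first by rewrite addr_ge0.
    have S0 : 0 <= ip (cfc (fun t => (t - s) ^+ 2) x) x.
      by rewrite -nrm_shift sqr_ge0.
    have [sn|ns] := ltP s (k ^+ n * a).
      by apply: le_trans (K1P s sab sn x) _; rewrite mulrDl lerDl mulr_ge0.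
    apply: le_trans (K2P s sab _ x) _; last by rewrite mulrDl lerDr mulr_ge0.
    by rewrite ns mulrA -exprS.
  split.
    apply: upper_bound_vanishes => //.
    by rewrite ltr_pMl// exprn_egt1.
  by case: U => K K0 KP; exists K => // s sab /ltW; exact: KP.
pose n := Num.truncn (b / a / e).
have bn : b < k ^+ n.+1 * a.
  rewrite -ltr_pdivrMr//; apply: lt_le_trans (bernoulli n.+1 (ltW e0)).
  apply: (@lt_le_trans _ _ (n.+1%:R * e)); last by rewrite lerDr.
  by rewrite -ltr_pdivrMr// truncnS_gt.
have T0 : T = 0.
  have [Vn _] := all_n n.+1.
  have := Vn (fun=> 1) (lip_cst _ _ _); rewrite (cfc_cst norm_dot sA ab A_ge A_le).
  rewrite scale1r mulr1; apply=> t /andP[_ tb] /(lt_le_trans bn).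
  by rewrite ltNge tb.
have XiE : Xi = cfc (fun t => (t `^ r)^-1) by apply/eqP; rewrite -subr_eq0 -/T T0.
by rewrite -[RHS]mulr1 -XiX mulrA XiE powV_cancel mul1r.
Qed.

End TangentBounds.

(** * Positive invertible operators *)

Section PositiveInvertible.
Context {R : realType} {H : completeNormedModType R[i]}.
Context (dot : {dot H for Num.conj}).
Context (norm_dot : forall x : H, `|x| ^+ 2 = dot x x).
Implicit Types (x y : H) (A B S T : bop H) (s t : R).

Local Notation ip := (ip dot).
Local Notation sa := (sa dot).
Local Notation psd := (psd dot).

Lemma posinvP A : bop_posinv dot A <-> [/\ sa A, psd A & bop_invertible A].
Proof.
split=> [[sA pA iA]|[sA pA iA]].
  have {}sA : sa A by apply/sa_selfadjoint.
  by split=> //; have /psd_bop_le := pA; rewrite subr0; apply=> //; exact: sa0.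
split=> //; first exact/sa_selfadjoint.
by apply/psd_bop_le => //; [exact: sa0|rewrite subr0].
Qed.

Lemma bop_invE A B : A * B = 1 -> B * A = 1 -> bop_inv A = B.
Proof.
move=> AB BA.
have [AC CA] : A * bop_inv A = 1 /\ bop_inv A * A = 1.
  by apply: (@xgetPex _ 0 [set C | A * C = 1 /\ C * A = 1]%classic); exists B.
by rewrite -[LHS]mulr1 -AB mulrA CA mul1r.
Qed.

Lemma bop_invP A : bop_invertible A -> A * bop_inv A = 1 /\ bop_inv A * A = 1.
Proof. by move=> [B [AB BA]]; rewrite (bop_invE AB BA). Qed.

Lemma posinv_inv A : bop_posinv dot A -> bop_posinv dot (bop_inv A).
Proof.
move=> /posinvP[sA pA /bop_invP[]]; set B := bop_inv A => AB BA.
have ABx x : A (B x) = x by rewrite -bopM_app AB.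
apply/posinvP; split; last by exists A.
  by move=> x y; rewrite -{1}(ABx y) -sA ABx.
by move=> x; rewrite -{2}(ABx x) -sA; exact: pA.
Qed.

Lemma posinvZ t A : 0 < t -> bop_posinv dot A -> bop_posinv dot (t%:C *: A).
Proof.
move=> t0 /posinvP[sA pA [B [AB BA]]]; apply/posinvP; split.
- exact: saZ.
- by move=> x; rewrite bop_appE ipZl mulr_ge0// ltW.
- exists (t^-1%:C *: B); rewrite !bopZl !bopZr !scalerA -!rmorphM AB BA.
  by rewrite mulfV ?mulVf ?gt_eqF// rmorph1 scale1r.
Qed.

Lemma posinv_conj A S T : bop_posinv dot A -> sa S -> S * T = 1 -> T * S = 1 ->
  bop_posinv dot (S * A * S).
Proof.
move=> /posinvP[sA pA [B [AB BA]]] sS ST TS; apply/posinvP; split.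
- exact: sa_conj.
- by move=> x; rewrite !bop_appE sS; exact: pA.
- exists (T * B * T); split.
    by rewrite !mulrA -(mulrA _ S) ST mulr1 -(mulrA S) AB mulr1.
  by rewrite !mulrA -(mulrA _ T) TS mulr1 -(mulrA T) BA mulr1.
Qed.

Lemma posinv_bounds A : bop_posinv dot A -> exists a b, [/\ 0 < a, a < b,
  (forall x, a * ip x x <= ip (A x) x) & (forall x, ip (A x) x <= b * ip x x)].
Proof.
move=> /posinvP[sA pA /invertible_bounded_below[c c0 cA]].
have [y y0 yA] := op_bound A; have y1 : 0 < y + 1 by rewrite ltr_wpDl.
have a0 : 0 < c ^+ 2 / (y + 1) by rewrite divr_gt0// exprn_gt0.
exists (c ^+ 2 / (y + 1)), (c ^+ 2 / (y + 1) + (y + 1)); split=> // [|x|x].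
- by rewrite ltrDl.
- rewrite mulrAC ler_pdivrMr// -(sqr_nrm norm_dot) -exprMn.
  apply: (@le_trans _ _ (nrm (A x) ^+ 2)).
    by rewrite ler_pXn2r ?nnegrE ?mulr_ge0 ?nrm_ge0// ltW.
  apply: le_trans (psd_sqr_le norm_dot x sA pA yA) _; rewrite mulrC.
  by rewrite ler_wpM2l// lerDl.
- apply: le_trans (ler_norm _) _; apply: le_trans (cauchy_schwarz norm_dot _ _) _.
  rewrite -(sqr_nrm norm_dot) expr2 mulrA ler_wpM2r ?nrm_ge0//.
  apply: le_trans (yA x) _; rewrite ler_wpM2r ?nrm_ge0//; lra.
Qed.

Lemma bop_powE A a b s : sa A -> 0 < a -> a < b ->
  (forall x, a * ip x x <= ip (A x) x) -> (forall x, ip (A x) x <= b * ip x x) ->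
  bop_pow A s = cfc A a b (fun t => t `^ s).
Proof.
move=> sA a0 ab Aa Ab; apply: (functional_calculusE norm_dot) => //.
exact: lip_powR.
Qed.

Lemma bop_pow_sqrt B : bop_posinv dot B ->
  [/\ sa (bop_pow B 2^-1) /\ sa (bop_pow B (- 2^-1)),
     bop_pow B 2^-1 * bop_pow B 2^-1 = B,
     bop_pow B 2^-1 * bop_pow B (- 2^-1) = 1 &
     bop_pow B (- 2^-1) * bop_pow B 2^-1 = 1].
Proof.
move=> pB; have [a [b [a0 ab Ba Bb]]] := posinv_bounds pB.
have /posinvP[sB _ _] := pB.
have lp s : lip_on a b (fun t => t `^ s) by exact: lip_powR.
have pow_add s u : bop_pow B s * bop_pow B u = bop_pow B (s + u).
  rewrite !(bop_powE _ sB a0 ab Ba Bb) -(cfcM norm_dot sB ab Ba Bb)//.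
  apply: (cfc_ext norm_dot sB ab Ba Bb) => [|t /andP[at_ _]]; first exact: lip_mul.
  by rewrite powRD// (gt_eqF (lt_le_trans a0 at_)) implybT.
have pow0 : bop_pow B 0 = 1.
  rewrite !(bop_powE _ sB a0 ab Ba Bb) -[RHS]scale1r.
  rewrite -(cfc_cst norm_dot sB ab Ba Bb).
  apply: (cfc_ext norm_dot sB ab Ba Bb) => // t _.
  exact: powRr0.
have pow1 : bop_pow B 1 = B.
  rewrite !(bop_powE _ sB a0 ab Ba Bb) -[RHS](cfc_id norm_dot sB ab Ba Bb).
  apply: (cfc_ext norm_dot sB ab Ba Bb) => [|t /andP[at_ _]] //.
  by rewrite powRr1// (le_trans (ltW a0)).
split.
- by rewrite !(bop_powE _ sB a0 ab Ba Bb); split; exact: (sa_cfc norm_dot sB ab Ba Bb).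
- by rewrite pow_add -[X in X + X]mul1r -splitr pow1.
- by rewrite pow_add subrr pow0.
- by rewrite pow_add addNr pow0.
Qed.

End PositiveInvertible.

Theorem theorem2p1 (R : realType) (H : completeNormedModType R[i])
  (dot : {dot H for Num.conj}) (norm_dot : forall x : H, `|x| ^+ 2 = dot x x)
  (r : R) (r_gt1 : 1 < r) (M : bop H -> bop H -> bop H)
  (M_posinv : forall A B : bop H, bop_posinv dot A -> bop_posinv dot B ->
    bop_posinv dot (M A B))
  (M_ge : forall A B : bop H, bop_posinv dot A -> bop_posinv dot B ->
    bop_le dot (r%:C *: A + (1 - r)%:C *: B) (M A B))
  (M_homogeneous : forall A B : bop H, bop_posinv dot A -> bop_posinv dot B ->
    forall t : R, 0 < t -> M (t%:C *: A) B = (t `^ r)%:C *: M A B)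
  (M_inv : forall A B : bop H, bop_posinv dot A -> bop_posinv dot B ->
    bop_inv (M A B) = M (bop_inv A) (bop_inv B)) :
  forall A B : bop H, bop_posinv dot A -> bop_posinv dot B ->
    M A B = geom_mean r A B.
Proof.
move=> A B pA pB.
(* the lower bound [M_ge] at [A0 / s], multiplied by [s^r]; used for [A], [B]
   with [S = B^(-1/2)] and for their inverses with [S = B^(1/2)] *)
have tangent_le A0 B0 S s (x : H) : bop_posinv dot A0 -> bop_posinv dot B0 ->
    sa dot S -> S * B0 * S = 1 -> 0 < s ->
    r * s `^ (r - 1) * ip dot ((S * A0 * S) x) x + (1 - r) * s `^ r * ip dot x x <=
    ip dot ((S * M A0 B0 * S) x) x.
  move=> pA0 pB0 sS SBS s0; have sV0 : 0 < s^-1 by rewrite invr_gt0.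
  have pA1 := posinvZ sV0 pA0.
  have /posinvP[sA0 _ _] := pA1; have /posinvP[sB0 _ _] := pB0.
  have /posinvP[sM0 _ _] := M_posinv _ _ pA1 pB0.
  have := M_ge _ _ pA1 pB0 => /psd_bop_le h.
  have {}h : psd dot (M (s^-1%:C *: A0) B0 -
      (r%:C *: (s^-1%:C *: A0) + (1 - r)%:C *: B0)).
    by apply: h => //; apply: saD; exact: saZ.
  have := h (S x); rewrite M_homogeneous// !bop_appE !ipE subr_ge0.
  rewrite powR_Vl//.
  have Bx : ip dot (B0 (S x)) (S x) = ip dot x x.
    by rewrite -sS -[S (B0 (S x))]/((S * B0 * S) x) SBS.
  have E T : ip dot (S (T (S x))) x = ip dot (T (S x)) (S x) by rewrite sS.
  rewrite Bx !E => h1; have sr0 : 0 < s `^ r by exact: powR_gt0.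
  have srE : s `^ r = s * s `^ (r - 1).
    by rewrite mulr_powRB1 ?ltW// (lt_trans ltr01).
  rewrite -(ler_pM2l sr0) mulVKf ?gt_eqF// in h1.
  apply: le_trans h1; rewrite srE le_eqVlt; apply/orP; left; apply/eqP.
  by field; rewrite gt_eqF.
have [[sh sg] hh hg gh] := bop_pow_sqrt norm_dot pB.
rewrite /geom_mean; set h := bop_pow B 2^-1 in sh hh hg gh *.
set g := bop_pow B (- 2^-1) in sg hg gh *.
have /posinvP[sM _ iM] := M_posinv _ _ pA pB.
have [MMi MiM] := bop_invP iM.
have pAi := posinv_inv pA; have pBi := posinv_inv pB.
have /posinvP[sMi _ _] := M_posinv _ _ pAi pBi.
have /posinvP[_ _ /bop_invP[AAi AiA]] := pA.
have Bi : bop_inv B = g * g.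
  apply: bop_invE; rewrite -hh !mulrA.
    by rewrite -(mulrA h h) hg mulr1 hg.
  by rewrite -(mulrA g g) gh mulr1 gh.
have gBg : g * B * g = 1 by rewrite -hh mulrA gh mul1r hg.
have hBh : h * bop_inv B * h = 1 by rewrite Bi mulrA hg mul1r gh.
have pC := posinv_conj pA sg gh hg; set C := g * A * g in pC *.
have /posinvP[sC _ _] := pC.
have [a [b [a0 ab Ca Cb]]] := posinv_bounds norm_dot pC.
have cancel_mid S T : S * T = 1 -> (g * S * g) * (h * T * h) = 1.
  by move=> ST; rewrite !mulrA -(mulrA _ g) gh mulr1 -(mulrA g) ST mulr1.
have cancel_mid' S T : S * T = 1 -> (h * S * h) * (g * T * g) = 1.
  by move=> ST; rewrite !mulrA -(mulrA _ h) hg mulr1 -(mulrA h) ST mulr1.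
pose X := g * M A B * g; pose Xi := h * M (bop_inv A) (bop_inv B) * h.
have sX : sa dot X by exact: sa_conj.
have sXi : sa dot Xi by exact: sa_conj.
have XXi : X * Xi = 1 by apply: cancel_mid; rewrite -M_inv.
have XiX : Xi * X = 1 by apply: cancel_mid'; rewrite -M_inv.
have lip_pt f s : lip_on a b f -> lip_on a b (fun t => pow_tangent r s (f t)).
  move=> lf; apply: lip_add (lip_cst _ _ _).
  exact: lip_mul (lip_cst _ _ _) lf.
have cfc_tangent f s (x : H) : lip_on a b f ->
    ip dot (cfc C a b (fun t => pow_tangent r s (f t)) x) x =
    r * s `^ (r - 1) * ip dot (cfc C a b f x) x + (1 - r) * s `^ r * ip dot x x.
  move=> lf; rewrite (cfcD norm_dot sC ab Ca Cb); last exact: lip_cst.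
    rewrite (cfcZ norm_dot sC ab Ca Cb)// (cfc_cst norm_dot sC ab Ca Cb).
    by rewrite !bop_appE !ipE.
  exact: lip_mul (lip_cst _ _ _) lf.
have XE : X = bop_pow C r.
  rewrite (bop_powE norm_dot r sC a0 ab Ca Cb).
  apply: (eq_pow_of_tangents norm_dot sC a0 ab r_gt1 Ca Cb sX sXi XXi XiX).
    move=> s s0 x; rewrite (cfc_tangent id); last exact: lip_id.
    by rewrite (cfc_id norm_dot sC ab Ca Cb); exact: tangent_le.
  move=> s s0 x; have lV : lip_on a b (fun t : R => t^-1).
    apply: (lip_inv a0 _ (lip_id _ _)) => t /andP[at_ _].
    by rewrite ger0_norm// (le_trans (ltW a0)).
  rewrite cfc_tangent//.
  have -> : cfc C a b (fun t => t^-1) = h * bop_inv A * h.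
    have [|] := cfc_inverse norm_dot sC ab Ca Cb a0 (lip_id _ _).
      by move=> t /andP[at_ _]; rewrite ger0_norm// (le_trans (ltW a0)).
    rewrite (cfc_id norm_dot sC ab Ca Cb) => CV _.
    rewrite -[RHS]mulr1 -CV mulrA.
    by rewrite cancel_mid'// mul1r.
  exact: tangent_le.
by rewrite -XE /X !mulrA hg mul1r -mulrA gh mulr1.
Qed.
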